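(* Let $w\ge 4$, $u=w-2$, $v=w-1$, let $\sum$ denote the sum over positive integers $a,b,c$ with $a+b+c=w$, and write $\tilde b=b-1$. Then, as identities of polynomials in $T$, \begin{align*} \sum 2\cdot 2^{\tilde b}\zeta_\sqcup(a,b,c)&=2\zeta_*(1,1,u)+w\zeta_*(1,v)-2\zeta(u,2)-\zeta(w),\\ \sum 2\cdot 2^{\tilde b}\zeta_\sqcup(a,\bar b,c)&=4\zeta(u,\bar1,\bar1)-4\zeta(u,\bar1,1)-2\zeta(\bar1,\bar1,u)+2\zeta(\bar1,1,u)+2\zeta_*(1,\bar1,u)+2\zeta(\bar v,\bar1)-2\zeta(\bar v,1)\\ &\quad+u\zeta_*(1,v)+2\zeta_*(1,\bar v)+4\zeta(\bar2,u)+2\zeta(u,2)+\zeta(w)+2\zeta(\bar w),\\ \sum 2\cdot 2^{\tilde b}\zeta(\bar a,b,c)&=2\zeta(\bar1,\bar1,\bar u)+w\zeta(\bar1,\bar v)+2\zeta(\bar v,\bar1)-2\zeta(\bar v,1)+\zeta(\bar2,\bar u)+\zeta(2,\bar u)+2\zeta(w)-\zeta(\bar w)+\zeta(2)\zeta(\bar u),\\ \sum 2\cdot 2^{\tilde b}\zeta(\bar a,\bar b,c)&=2\zeta(\bar1,\bar1,\bar u)+u\zeta(\bar1,\bar v)+2\zeta(\bar1,v)+\zeta(\bar2,\bar u)+\zeta(2,\bar u)+\zeta(\bar w),\\ \sum 2^{\tilde b}\big(\zeta_\sqcup(\bar a,\bar b,\bar c)+\zeta_\sqcup(\bar a,b,\bar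 c)\big)&=2\zeta(u,\bar1,1)+2\zeta(\bar1,\bar1,u)-2\zeta(u,\bar1,\bar1)+v\zeta(\bar1,v)+\zeta(\bar v,1)+\zeta(\bar1,\bar v)\\ &\quad-\zeta(\bar v,\bar1)+\zeta(2,u)-\zeta(u,2),\\ \sum 2^{\tilde b}\big(\zeta_\sqcup(a,b,\bar c)+\zeta_\sqcup(a,\bar b,\bar c)\big)&=\zeta_*(1,\bar1,\bar u)+\zeta(\bar1,1,\bar u)-\zeta(\bar1,\bar1,\bar u)+\zeta_*(1,1,\bar u)-\zeta(\bar v,\bar1)+\zeta(\bar v,1)\\ &\quad+\zeta_*(1,v)+v\zeta_*(1,\bar v)+\zeta(\bar2,\bar u)+\zeta(2,\bar u)+\zeta(\bar w)+3\zeta(\bar2)\zeta(\bar u). \end{align*}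
   Context: Euler sums: for positive integers $s_j$ and $z_j\in\{\pm1\}$, $\zeta(s_1,\dots,s_d;z_1,\dots,z_d)=\sum_{n_1>\dots>n_d>0}\frac{z_1^{n_1}\cdots z_d^{n_d}}{n_1^{s_1}\cdots n_d^{s_d}}$, convergent iff $(s_1,z_1)\ne(1,1)$; a bar over the $j$-th argument means $z_j=-1$, no bar means $z_j=1$. Regularized values: the truncated sum $\zeta^{(M)}$ (restricted to $M\ge n_1$) has, as $M\to\infty$, an expansion $P(\log M+\gamma)+o(1)$ with $P$ a polynomial ($\gamma$ Euler's constant); $\zeta_*:=P(T)\in\mathbb{R}[T]$. With $a_k=\prod_{j\le k}z_j$, $\int_0^{1-\varepsilon}\left(\frac{dt}{t}\right)^{s_1-1}\frac{dt}{a_1-t}\cdots\left(\frac{dt}{t}\right)^{s_d-1}\frac{dt}{a_d-t}$ (iterated integral over $1-\varepsilon>t_1>t_2>\dots>0$, forms read left to right) has, as $\varepsilon\to0^+$, an expansion $Q(-\log\varepsilon)+o(1)$; $\zeta_\sqcup:=Q(T)$. Both equal the Euler sum for convergent indices. *)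

(* Defs.v *)
From HB Require Import structures.
From mathcomp Require Import all_boot all_order all_algebra.
From mathcomp Require Import all_classical all_reals all_analysis.
Set Implicit Arguments. Unset Strict Implicit. Unset Printing Implicit Defensive.
Import Order.TTheory GRing.Theory Num.Theory.
Import numFieldNormedType.Exports.
Local Open Scope classical_set_scope.
Local Open Scope ring_scope.

(* An eindex is a list of pairs (s_j, barred_j); barred_j = true means z_j = -1. *)
Definition eindex := seq (nat * bool).
Definition unb (s : nat) : nat * bool := (s, false).
Definition bar (s : nat) : nat * bool := (s, true).

Section EulerSums.
Variable R : realType.

Definition sgn (b : bool) : R := if b then -1 else 1.

Fixpoint zeta_trunc (M : nat) (k : eindex) : R :=
  match k with
  | [::] => 1
  | (s, z) :: k' =>
      \sum_(1 <= n < M.+1) (sgn z ^+ n / (n%:R ^+ s)) * zeta_trunc n.-1 k'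
  end.

Definition zeta (k : eindex) : R := limn (fun M => zeta_trunc M k).

Definition euler_gamma : R :=
  limn (fun n : nat => \sum_(1 <= j < n.+1) (j%:R)^-1 - ln (n%:R : R)).

Definition stuffle_reg (k : eindex) (P : {poly R}) : Prop :=
  (fun M : nat => zeta_trunc M k - P.[ln (M%:R : R) + euler_gamma]) @ \oo --> 0.

Definition zeta_st (k : eindex) : {poly R} := xget 0 [set P | stuffle_reg k P].

(* differential forms: letter a = 0 encodes dt/t, letter a = +-1 encodes dt/(a-t) *)
Definition omega (a t : R) : R := if a == 0 then t^-1 else (a - t)^-1.

(* word of forms (dt/t)^{s_1-1} dt/(a_1-t) ... (dt/t)^{s_d-1} dt/(a_d-t),
   a_k = z_1 ... z_k *)
Fixpoint word_aux (acc : R) (k : eindex) : seq R :=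
  match k with
  | [::] => [::]
  | (s, z) :: k' =>
      let a := acc * sgn z in nseq s.-1 0 ++ a :: word_aux a k'
  end.
Definition word (k : eindex) : seq R := word_aux 1 k.

Fixpoint iterint (x : R) (ws : seq R) : R :=
  match ws with
  | [::] => 1
  | a :: ws' =>
      Rintegral (@lebesgue_measure R) `[0, x] (fun t => omega a t * iterint t ws')
  end.

Definition shuffle_reg (k : eindex) (Q : {poly R}) : Prop :=
  (fun eps : R => iterint (1 - eps) (word k) - Q.[- ln eps]) @ at_right 0 --> 0.

Definition zeta_sh (k : eindex) : {poly R} := xget 0 [set Q | shuffle_reg k Q].

Definition sum3 (w : nat) (F : nat -> nat -> nat -> {poly R}) : {poly R} :=
  \sum_(1 <= a < w) \sum_(1 <= b < w) \sum_(1 <= c < w | (a + b + c == w)%N) F a b c.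

End EulerSums.

(* Main.v *)
Require Import Defs.
From HB Require Import structures.
From mathcomp Require Import all_boot all_order all_algebra.
From mathcomp Require Import all_classical all_reals all_analysis.
From mathcomp Require Import ring lra zify.
Set Implicit Arguments. Unset Strict Implicit. Unset Printing Implicit Defensive.
Import Order.TTheory GRing.Theory Num.Theory.
Import numFieldNormedType.Exports.
Local Open Scope ring_scope.

(** Writing ω_0 = dt/t, ω_a = dt/(a-t), each weighted sum on the left is a sum of iterated
integrals ω_0^{a-1} ω_α (ω_0^{b-1} ω_β ⧢ ω_0^{c-1} ω_γ) with α, β, γ = ±1, because a shuffle
of the two inner words over all exponents of fixed total puts the weight 2^{b-1} on each word.
The coefficients of its power series therefore add up to
Σ α^k β^x γ^y h(x, y, z) over x + y + k = z <= M, where h is the sum of z^-a x^-b y^-c over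
a + b + c = w.  Partial fractions write h as x^-u/((z-x)(y-x)) + y^-u/((z-y)(x-y))
+ z^-u/((z-x)(z-y)), with a degenerate term on x = y, and after changes of summation variables
every piece is a combination of truncated Euler sums and of their (stuffle) products, up to an
error O(M^(-1/2)).  The only defect is the Cauchy product of two harmonic series, which differs
from the product of the truncated series by -ζ(2) in the limit; it accounts for the ζ(2)-terms
and for the passage between the two regularizations.

Truncated sums satisfy ζ^(M) = P(H_M) + O(M^(-1/2)) with deg P <= 2 and H_M = log M + γ + O(1/M),
so ζ_* = P.  The iterated integral at x is the Abel mean (1-x) Σ ζ^(n) x^n, and the Abel mean of
H_n^2 is log^2(1-x) + Li_2(x), so ζ_⧢ = P + ζ(2) [T^2]P. *)

(** * Sums from 1 to N and partial fractions *)

(** A rate, not merely o(1), is carried throughout because prefixing an argument 1 divides by n and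
    sums: an error O(n^(-1/2)) stays summable, with a tail of the same order, whereas o(1) would
    give nothing. The exponent 1/2 leaves room for the factor H_n^2 that depth three can produce,
    since H_n = O(n^(1/4)) has an elementary proof. Expansions are kept in powers of H_n, which are
    compatible with prefixing 1, and log n enters only in the final comparison. The obstacle is the
    cut-off: after each change of variables the ranges read q <= M - x instead of q <= M. The weight
    x^-u with u >= 2 makes these corners cost only O(H_M^2/M). Everything else is an exact identity
    of finite sums. Each of the six cases thus becomes a polynomial identity in truncated sums,
    checked by [ring] or [field] modulo null sequences: the Cauchy defects with at least one sign,
    and ζ^(M)(2) + 2 ζ^(M)(bar 2). Weight at least 4 excludes (1,1,1), the only source of T^3. *)

Section Sum1.
Variable V : zmodType.
Implicit Types (f g : nat -> V) (N : nat).

Definition sum1 N f : V := \sum_(1 <= i < N.+1) f i.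

Lemma sum1_0 f : sum1 0 f = 0.
Proof. by rewrite /sum1 big_geq. Qed.

Lemma sum1S N f : sum1 N.+1 f = sum1 N f + f N.+1.
Proof. by rewrite /sum1 big_nat_recr. Qed.

Lemma eq_sum1 N f g :
  (forall i, (0 < i <= N)%N -> f i = g i) -> sum1 N f = sum1 N g.
Proof. by move=> fg; apply: eq_big_nat => i /fg. Qed.

Lemma sum1D N f g : sum1 N (fun i => f i + g i) = sum1 N f + sum1 N g.
Proof. exact: big_split. Qed.

Lemma sum1N N f : sum1 N (fun i => - f i) = - sum1 N f.
Proof. by rewrite /sum1 sumrN. Qed.

Lemma sum1B N f g : sum1 N (fun i => f i - g i) = sum1 N f - sum1 N g.
Proof. by rewrite sum1D sum1N. Qed.

Lemma sum1_recl N f : sum1 N.+1 f = f 1%N + sum1 N (fun i => f i.+1).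
Proof. by rewrite /sum1 big_nat_recl // big_add1. Qed.

Lemma sum1_rev N f : sum1 N f = sum1 N (fun i => f (N.+1 - i)%N).
Proof.
rewrite /sum1 big_nat_rev /=; apply: eq_big_nat => i /andP[i0 iN].
by congr f; rewrite add1n subSS.
Qed.

Lemma sum1_split x N f : (x <= N)%N ->
  sum1 N f = sum1 x f + sum1 (N - x) (fun i => f (x + i)%N).
Proof.
move=> /subnKC <-; rewrite addKn; elim: (N - x)%N => [|d IH].
  by rewrite sum1_0 addn0 addr0.
by rewrite addnS !sum1S IH addrA addnS.
Qed.

Lemma sum1_tri N (g : nat -> nat -> V) :
  sum1 N (fun m => sum1 m.-1 (fun x => g x (m - x)%N)) =
  sum1 N (fun x => sum1 (N - x) (fun y => g x y)).
Proof.
elim: N => [|N IH]; first by rewrite !sum1_0.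
rewrite sum1S IH [RHS]sum1S subnn sum1_0 addr0 /= -sum1D.
by apply: eq_sum1 => i /andP[i0 iN]; rewrite subSn // sum1S.
Qed.

Lemma sum1_exch N (g : nat -> nat -> V) :
  sum1 N (fun r => sum1 r.-1 (fun x => g r x)) =
  sum1 N (fun x => sum1 (N - x) (fun i => g (x + i)%N x)).
Proof.
rewrite -(sum1_tri N (fun x y => g (x + y)%N x)).
apply: eq_sum1 => i /andP[i0 iN]; apply: eq_sum1 => j /andP[j0 ji].
by rewrite subnKC //; lia.
Qed.

Lemma sum1_swap N M (g : nat -> nat -> V) :
  sum1 N (fun i => sum1 M (g i)) = sum1 M (fun j => sum1 N (g^~ j)).
Proof. exact: exchange_big. Qed.

Lemma sum1_eq0 N f : (forall i, (0 < i <= N)%N -> f i = 0) -> sum1 N f = 0.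
Proof. by move=> f0; rewrite (@eq_sum1 _ _ (fun=> 0)) // /sum1 big1. Qed.

Lemma sum3_sum1 (u : nat) (F : nat -> nat -> nat -> V) :
  \sum_(1 <= a < u.+2) \sum_(1 <= b < u.+2)
     \sum_(1 <= c < u.+2 | (a + b + c == u.+2)%N) F a b c =
  sum1 u (fun a => sum1 (u.+1 - a) (fun b => F a b (u.+2 - a - b)%N)).
Proof.
rewrite -/(sum1 u.+1 _) sum1S [X in _ + X]big_nat [X in _ + X]big1 ?addr0; last first.
  move=> b /andP[b0 bu]; rewrite big_nat_cond big1 // => c; lia.
apply: eq_sum1 => a /andP[a0 au].
rewrite -/(sum1 u.+1 _) (@sum1_split (u.+1 - a)); last by lia.
rewrite [X in _ + X]sum1_eq0 ?addr0; last first.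
  move=> b /andP[b0 bu]; rewrite big_nat_cond big1 // => c; lia.
apply: eq_sum1 => b /andP[b0 bu].
rewrite big_mkcond (bigD1_seq (u.+2 - a - b)%N) ?iota_uniq //; last first.
  by rewrite mem_iota; lia.
rewrite ifT; last by lia.
rewrite big_nat_cond big1 => [|c /andP[_ cne]]; first exact: addr0.
by rewrite ifF //; lia.
Qed.

End Sum1.

Section Sum1Ring.
Variable A : pzRingType.
Implicit Types (f : nat -> A) (N : nat).

Lemma sum1Ml N (c : A) f : sum1 N (fun i => c * f i) = c * sum1 N f.
Proof. by rewrite /sum1 mulr_sumr. Qed.

Lemma sum1Mr N (c : A) f : sum1 N (fun i => f i * c) = sum1 N f * c.
Proof. by rewrite /sum1 mulr_suml. Qed.

End Sum1Ring.

(** * Partial fractions for the summand *)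

Section PartialFractions.
Variable F : numFieldType.
Implicit Types x y z : F.

(** The middle summation variable is [x + y], the innermost one is [x] or [y]. This is the shuffle
    form of the sum of x^-b y^-c over b, c >= 1 with b + c = N + 1, which is a geometric sum. *)
Definition homog2 (N : nat) x y : F :=
  sum1 N (fun b => 2 ^+ b.-1 / (x + y) ^+ b *
                   (x ^- (N.+1 - b) + y ^- (N.+1 - b))).

Lemma homog2S N x y :
  homog2 N.+1 x y = (2 * homog2 N x y + x ^- N.+1 + y ^- N.+1) / (x + y).
Proof.
rewrite /homog2 sum1_recl /= expr0 expr1 subSS subn0 mul1r.
rewrite (@eq_sum1 _ N _ (fun b => (2 / (x + y)) * (2 ^+ b.-1 / (x + y) ^+ b *
                   (x ^- (N.+1 - b) + y ^- (N.+1 - b))))); last first.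
  move=> [|b] //= _; rewrite subSS exprS [(x + y) ^+ b.+2]exprS invfM; ring.
rewrite sum1Ml; ring.
Qed.

(** The factor 2 in the recursion is what closes the induction: 2(x^-N - y^-N) + (x^-(N+1) +
    y^-(N+1))(y - x) equals (x + y)(x^-(N+1) - y^-(N+1)). *)
Lemma homog2_neq N x y : x != 0 -> y != 0 -> x + y != 0 ->
  homog2 N x y * (y - x) = x ^- N - y ^- N.
Proof.
move=> x0 y0 xy0; elim: N => [|N IH].
  by rewrite /homog2 sum1_0 mul0r !expr0 subrr.
have -> : homog2 N.+1 x y * (y - x) =
    (2 * (homog2 N x y * (y - x)) + (x ^- N.+1 + y ^- N.+1) * (y - x)) / (x + y).
  rewrite homog2S; ring.
rewrite IH !exprS; field.
by rewrite x0 y0 xy0 !expf_neq0.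
Qed.

Lemma homog2_eq N x : x != 0 -> homog2 N x x = N%:R * x ^- N.+1.
Proof.
move=> x0; elim: N => [|N IH]; first by rewrite /homog2 sum1_0 mul0r.
have x20 : x + x != 0 by rewrite -mulr2n mulrn_eq0.
rewrite homog2S IH -[N.+1%:R]natr1 !exprS; field.
by rewrite x0 expf_neq0 // x20.
Qed.

(** The total degree is -(u + 2): the exponent a sits on z, and [homog2] distributes the remaining u
    + 2 - a over x and y. *)
Definition homog3 (u : nat) x y z : F :=
  sum1 u (fun a => z ^- a * homog2 (u.+1 - a) x y).

Lemma homog3S u x y z :
  homog3 u.+1 x y z = (homog3 u x y z + homog2 u.+1 x y) / z.
Proof.
rewrite /homog3 sum1_recl expr1 subSS subn0.
rewrite (@eq_sum1 _ u _ (fun a => z^-1 * (z ^- a * homog2 (u.+1 - a) x y))).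
  by rewrite sum1Ml; ring.
by move=> a _; rewrite subSS exprS invfM; ring.
Qed.

Lemma homog3_neq u x y z : x != 0 -> y != 0 -> x + y != 0 -> z != 0 ->
  x != y -> z != x -> z != y ->
  homog3 u x y z = x ^- u / ((z - x) * (y - x)) +
    y ^- u / ((z - y) * (x - y)) + z ^- u / ((z - x) * (z - y)).
Proof.
move=> x0 y0 xy0 z0; rewrite -subr_eq0 => xy; rewrite -subr_eq0 => zx.
rewrite -subr_eq0 => zy; have yx : y - x != 0 by rewrite -opprB oppr_eq0.
elim: u => [|u IH].
  by rewrite /homog3 sum1_0 !expr0; field; rewrite xy yx zx zy.
have H2 : homog2 u.+1 x y = (x ^- u.+1 - y ^- u.+1) / (y - x).
  by rewrite -homog2_neq // mulfK.
rewrite homog3S IH H2 !exprS; field.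
by rewrite x0 y0 z0 !expf_neq0 // xy yx zx zy.
Qed.

Lemma homog3_eq u x z : x != 0 -> z != 0 -> z != x ->
  homog3 u x x z = u%:R * x ^- u.+1 / (z - x) - x ^- u / (z - x) ^+ 2
    + z ^- u / (z - x) ^+ 2.
Proof.
move=> x0 z0; rewrite -subr_eq0 => zx.
elim: u => [|u IH].
  by rewrite /homog3 sum1_0 !mul0r !expr0; field.
rewrite homog3S IH homog2_eq // -natr1 !exprS; field.
by rewrite x0 z0 !expf_neq0 // zx.
Qed.

End PartialFractions.

(** * Truncated Euler sums *)

Arguments zeta_trunc : simpl never.

Section TruncatedSums.
Variable R : realType.
Implicit Types (M N n x y z q r : nat) (al be ga : bool) (s t : nat * bool).

Local Notation zt := (@zeta_trunc R).

Definition ch a n : R := sgn R a ^+ n.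

Lemma ch_addb a b n : ch (a (+) b) n = ch a n * ch b n.
Proof. by rewrite /ch -exprMn; case: a b => [] []; rewrite /= ?mulrNN ?mulr1 ?mul1r. Qed.

Lemma chD a m n : ch a (m + n) = ch a m * ch a n.
Proof. exact: exprD. Qed.

Lemma ch_sqr a n : ch a n * ch a n = 1.
Proof.
by rewrite /ch -exprMn; case: a; rewrite /= ?mulrNN mulr1 expr1n.
Qed.

Lemma chB a m n : (n <= m)%N -> ch a (m - n) = ch a m * ch a n.
Proof. by move=> nm; rewrite -{2}(subnK nm) chD -mulrA ch_sqr mulr1. Qed.

Lemma norm_ch a n : `|ch a n| = 1.
Proof. by rewrite /ch normrX; case: a; rewrite /= ?normrN normr1 expr1n. Qed.

Lemma ch_false n : ch false n = 1. Proof. exact: expr1n. Qed.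

Definition wt s n : R := ch s.2 n / n%:R ^+ s.1.

Lemma zt_nil M : zt M [::] = 1. Proof. by []. Qed.

Lemma zt_cons M s k : zt M (s :: k) = sum1 M (fun n => wt s n * zt n.-1 k).
Proof. by case: s. Qed.

Lemma zt_0 s k : zt 0 (s :: k) = 0.
Proof. by rewrite zt_cons sum1_0. Qed.

Lemma ztS M s k : zt M.+1 (s :: k) = zt M (s :: k) + wt s M.+1 * zt M k.
Proof. by rewrite !zt_cons sum1S. Qed.

Lemma ztP M s k : (0 < M)%N ->
  zt M (s :: k) = zt M.-1 (s :: k) + wt s M * zt M.-1 k.
Proof. by case: M => // M _; rewrite ztS. Qed.

Lemma zt1 M s : zt M [:: s] = sum1 M (wt s).
Proof. by rewrite zt_cons; apply: eq_sum1 => n _; rewrite zt_nil mulr1. Qed.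

Definition emerge s t : nat * bool := ((s.1 + t.1)%N, s.2 (+) t.2).

Lemma wt_emerge s t n : wt (emerge s t) n = wt s n * wt t n.
Proof. by rewrite /wt ch_addb exprD invfM; ring. Qed.

Lemma stuffle11 M s t :
  zt M [:: s] * zt M [:: t] = zt M [:: s; t] + zt M [:: t; s] + zt M [:: emerge s t].
Proof.
elim: M => [|M IH]; first by rewrite !zt_0; ring.
transitivity (zt M [:: s] * zt M [:: t] + wt t M.+1 * zt M [:: s] +
   wt s M.+1 * zt M [:: t] + wt s M.+1 * wt t M.+1).
  by rewrite !ztS !zt_nil; ring.
by rewrite IH !ztS wt_emerge !zt_nil; ring.
Qed.

Lemma stuffle12 M s t k :
  zt M [:: s] * zt M [:: t; k] = zt M [:: s; t; k] + zt M [:: t; s; k] +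
    zt M [:: t; k; s] + zt M [:: emerge s t; k] + zt M [:: t; emerge s k].
Proof.
elim: M => [|M IH]; first by rewrite !zt_0; ring.
transitivity (zt M [:: s] * zt M [:: t; k] +
   wt t M.+1 * (zt M [:: s] * zt M [:: k]) +
   wt s M.+1 * zt M [:: t; k] + wt s M.+1 * wt t M.+1 * zt M [:: k]).
  by rewrite !ztS !zt_nil; ring.
by rewrite IH stuffle11 !ztS wt_emerge; ring.
Qed.

Definition conv11 N a b : R :=
  sum1 N (fun i => wt (1%N, a) i * zt (N - i) [:: (1%N, b)]).

(** Passing from N to N + 1 adds the antidiagonal i + j = N + 1 of a Cauchy product, where 1/(ij) =
    (1/i + 1/j)/(N + 1), and the sign a^i b^j is b^(N+1) (ab)^i or a^(N+1) (ab)^j. *)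
Lemma conv11E N a b : conv11 N a b =
  zt N [:: (1%N, a); (1%N, a (+) b)] + zt N [:: (1%N, b); (1%N, a (+) b)].
Proof.
elim: N => [|N IH]; first by rewrite /conv11 sum1_0 !zt_0 addr0.
rewrite !ztS addrACA -IH /conv11 sum1S subnn zt_0 mulr0 addr0.
rewrite (@eq_sum1 _ N _ (fun i => wt (1%N, a) i * zt (N - i) [:: (1%N, b)] +
   (wt (1%N, b) N.+1 * wt (1%N, a (+) b) i +
    ch a i * ch b (N.+1 - i) / (N.+1)%:R / (N.+1 - i)%:R))); last first.
  move=> i /andP[i0 iN]; rewrite subSn // ztS zt_nil mulr1 mulrDr; congr (_ + _).
  rewrite -subSn // /wt /= ch_addb !chB ?(leq_trans iN) // !expr1.
  have iN1 : i%:R + (N.+1 - i)%:R = N.+1%:R :> R.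
    by rewrite -natrD subnKC // ltnW.
  have iR : i%:R != 0 :> R by rewrite pnatr_eq0 -lt0n.
  have NR : N.+1%:R != 0 :> R by rewrite pnatr_eq0.
  have NiR : (N.+1 - i)%:R != 0 :> R by rewrite pnatr_eq0 -lt0n subn_gt0.
  move: iN1 iR NR NiR; move: (i%:R : R) (N.+1%:R : R) ((N.+1 - i)%:R : R).
  move=> X Y Z <- X0 XZ0 Z0; field.
  by rewrite X0 XZ0 Z0.
rewrite sum1D sum1D; congr (_ + _).
rewrite sum1Ml -zt1 addrC; congr (_ + _).
rewrite sum1_rev zt1 -sum1Ml; apply: eq_sum1 => i /andP[i0 iN].
by rewrite subKn ?(leq_trans iN) // /wt /= ch_addb chB ?(leq_trans iN) // !expr1; ring.
Qed.

Lemma sum1_swap2 (u M : nat) (v : nat -> nat) (F : nat -> nat -> nat -> R) :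
  sum1 u (fun a => sum1 (v a) (fun b => sum1 M (F a b))) =
  sum1 M (fun z => sum1 u (fun a => sum1 (v a) (fun b => F a b z))).
Proof.
rewrite sum1_swap; apply: eq_sum1 => a _; exact: sum1_swap.
Qed.

(** The three signs attach to the gaps z - m, x and m - x of the nested variables; this is the
    effect of the partial products a_k in the iterated integral. *)
Definition simplex_term u al be ga z m x : R :=
  ch al (z - m) * ch be x * ch ga (m - x) * homog3 u x%:R (m - x)%:R z%:R.

Definition simplex_sum u al be ga M : R :=
  sum1 M (fun z => sum1 z.-1 (fun m => sum1 m.-1 (simplex_term u al be ga z m))).

Lemma weighted_sum_simplex u al be ga M :
  sum1 u (fun a => sum1 (u.+1 - a) (fun b => 2 ^+ b.-1 *
    (zt M [:: (a, al); (b, al (+) be); ((u.+2 - a - b)%N, be (+) ga)] +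
     zt M [:: (a, al); (b, al (+) ga); ((u.+2 - a - b)%N, be (+) ga)]))) =
  simplex_sum u al be ga M.
Proof.
pose G a b z m x := 2 ^+ b.-1 * (wt (a, al) z * (wt (b, al (+) be) m *
   wt ((u.+2 - a - b)%N, be (+) ga) (m - x)%N + wt (b, al (+) ga) m *
   wt ((u.+2 - a - b)%N, be (+) ga) x)).
transitivity (sum1 u (fun a => sum1 (u.+1 - a) (fun b => sum1 M (fun z =>
   sum1 z.-1 (fun m => sum1 m.-1 (G a b z m)))))).
  apply: eq_sum1 => a _; apply: eq_sum1 => b _.
  rewrite !zt_cons -sum1D -sum1Ml; apply: eq_sum1 => z _.
  rewrite -mulrDr !zt_cons -sum1D -!sum1Ml; apply: eq_sum1 => m /andP[m0 _].
  (* The innermost variable of the first sum is reflected to m - x, so that in both sums [x] carries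
     the sign [be] and [m - x] carries [ga]. *)
  rewrite !zt1 [in X in _ * (_ * (X + _))]sum1_rev -!sum1Ml -sum1D -!sum1Ml.
  by apply: eq_sum1 => x _; rewrite /G prednK.
rewrite sum1_swap2; apply: eq_sum1 => z /andP[z0 _].
rewrite sum1_swap2; apply: eq_sum1 => m /andP[m0 mz].
rewrite sum1_swap2; apply: eq_sum1 => x /andP[x0 xm].
have mz' : (m <= z)%N by lia.
have xm' : (x <= m)%N by lia.
rewrite /simplex_term /homog3 -sum1Ml; apply: eq_sum1 => a /andP[a0 au].
rewrite /homog2 -!sum1Ml; apply: eq_sum1 => b /andP[b0 bu].
have -> : ((u.+1 - a).+1 - b = u.+2 - a - b)%N by lia.
rewrite -natrD subnKC // /G /wt /= !ch_addb !chB //.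
pose X : R := x%:R ^- (u.+2 - a - b); pose Y : R := (m - x)%:R ^- (u.+2 - a - b).
rewrite -/X -/Y.
transitivity (2 ^+ b.-1 * z%:R ^- a * m%:R ^- b * ch al z * ch al m *
   (Y * ((ch be m * ch be m) * ch be x * (ch ga m * ch ga x)) +
    X * (ch ga m * ch be x * ch ga x))).
  rewrite -/X -/Y; ring.
by rewrite ch_sqr; ring.
Qed.

(** In the variables y = m - x and q = z - x the condition m < z reads y < q, but z <= M becomes q
    <= M - x: this is where the corners originate. *)
Lemma sum1_simplex M (f : nat -> nat -> nat -> R) :
  sum1 M (fun z => sum1 z.-1 (fun m => sum1 m.-1 (fun x => f x (m - x)%N (z - x)%N))) =
  sum1 M (fun x => sum1 (M - x) (fun q => sum1 q.-1 (fun y => f x y q))).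
Proof.
rewrite -(sum1_tri M (fun x q => sum1 q.-1 (fun y => f x y q))).
apply: eq_sum1 => z _; rewrite (sum1_tri z.-1 (fun x y => f x y (z - x)%N)).
by apply: eq_sum1 => x _; congr sum1; lia.
Qed.

(** The term y = x is 1/0 = 0, so the diagonal is excluded by convention; the degenerate partial
    fraction is treated separately. *)
Definition innerE al ga N x : R :=
  sum1 N (fun q => wt (1%N, al) q *
    sum1 q.-1 (fun y => ch (al (+) ga) y / (y%:R - x%:R))).

Definition partA u al be ga M : R :=
  sum1 M (fun x => wt (u, be) x * innerE al ga (M - x) x).

Definition partC u al be ga M : R :=
  sum1 M (fun z => sum1 z.-1 (fun m => sum1 m.-1 (fun x =>
    ch al (z - m) * ch be x * ch ga (m - x) *
    (z%:R ^- u / ((z%:R - x%:R) * (z%:R - (m - x)%:R)))))).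

(** The diagonal y = x, with q = z - x. Only two of the three terms of [homog3_eq] appear: the
    third, z^-u/(z - x)^2, is already the diagonal of [partC]. *)
Definition partD u al be ga M : R :=
  sum1 M (fun x => sum1 (M - x) (fun q => if (x < q)%N then
    ch al (q - x) * ch (be (+) ga) x *
     (u%:R * x%:R ^- u.+1 / q%:R - x%:R ^- u / q%:R ^+ 2) else 0)).

Lemma natr_neq m n : m != n -> m%:R != n%:R :> R.
Proof. by rewrite eqr_nat. Qed.

Lemma simplex_sumE u al be ga M : simplex_sum u al be ga M =
  partA u al be ga M + partA u al ga be M + partC u al be ga M + partD u al be ga M.
Proof.
pose fA (be ga : bool) x y q : R := ch al (q - y) * ch be x * ch ga y *
  (x%:R ^- u / (q%:R * (y%:R - x%:R))).
pose fD x y q : R := if y == x then ch al (q - x) * ch (be (+) ga) x *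
     (u%:R * x%:R ^- u.+1 / q%:R - x%:R ^- u / q%:R ^+ 2) else 0.
have partAE be' ga' : partA u al be' ga' M = sum1 M (fun z => sum1 z.-1 (fun m =>
    sum1 m.-1 (fun x => fA be' ga' x (m - x)%N (z - x)%N))).
  rewrite sum1_simplex /partA; apply: eq_sum1 => x _.
  rewrite /innerE -sum1Ml; apply: eq_sum1 => q /andP[q0 _].
  rewrite -!sum1Ml; apply: eq_sum1 => y /andP[y0 yq].
  by rewrite /fA /wt /= ch_addb chB ?(leq_trans yq) ?leq_pred // expr1 invfM; ring.
have partDE : partD u al be ga M = sum1 M (fun z => sum1 z.-1 (fun m =>
    sum1 m.-1 (fun x => fD x (m - x)%N (z - x)%N))).
  rewrite sum1_simplex /partD; apply: eq_sum1 => x /andP[x0 _].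
  apply: eq_sum1 => q /andP[q0 _]; case: ltnP => xq.
    rewrite (@sum1_split _ x.-1); last by lia.
    rewrite sum1_eq0; last by move=> i Hi; rewrite /fD ifF //; lia.
    have -> : (q.-1 - x.-1 = (q.-1 - x).+1)%N by lia.
    rewrite sum1_recl sum1_eq0; last by move=> i Hi; rewrite /fD ifF //; lia.
    by rewrite /fD ifT ?add0r ?addr0 //; lia.
  by rewrite sum1_eq0 // => i Hi; rewrite /fD ifF //; lia.
rewrite !partAE partDE /partC /simplex_sum -!sum1D; apply: eq_sum1 => z /andP[z0 _].
rewrite -!sum1D; apply: eq_sum1 => m /andP[m0 mz].
(* Reflecting x to m - x in the second copy of [partA] exchanges x and y and yields the partial
   fraction over (z - y)(x - y). *)
rewrite [X in _ + X + _ + _]sum1_rev -!sum1D; apply: eq_sum1 => x /andP[x0 xm].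
rewrite prednK // /simplex_term.
pose y := (m - x)%N; have y0 : (0 < y)%N by rewrite /y; lia.
have -> : m = (x + y)%N by rewrite /y; lia.
pose k := (z - (x + y))%N; have k0 : (0 < k)%N by rewrite /k /y; lia.
have -> : z = (x + y + k)%N by rewrite /k /y; lia.
move: y k y0 k0 => {z z0 mz m m0 xm} y k y0 k0.
have -> : (x + y - x = y)%N by lia.
have -> : (x + y - y = x)%N by lia.
have -> : (x + y + k - (x + y) = k)%N by lia.
have -> : (x + y + k - x = y + k)%N by lia.
have -> : (x + y + k - y = x + k)%N by lia.
have Ezx : (x + y + k)%:R - x%:R = (y + k)%:R :> R by rewrite !natrD; ring.
have Ezy : (x + y + k)%:R - y%:R = (x + k)%:R :> R by rewrite !natrD; ring.
have nz n : (0 < n)%N -> n%:R != 0 :> R by rewrite pnatr_eq0 -lt0n.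
rewrite /fA /fD; have [E|yx] := eqVneq y x.
  subst y; rewrite homog3_eq ?nz ?natr_neq //; try lia.
  rewrite Ezx subrr mulr0 invr0 !mulr0 !add0r.
  have -> : (x + k - x = k)%N by lia.
  by rewrite ch_addb -expr2; ring.
rewrite homog3_neq ?nz ?natr_neq //; try lia; last by rewrite -natrD nz //; lia.
rewrite Ezx Ezy addr0.
have -> : (y + k - y = k)%N by lia.
have -> : (x + k - x = k)%N by lia.
by ring.
Qed.

End TruncatedSums.

(** * Each piece in terms of truncated sums, Cauchy products and corners *)

Section Parts.
Variable R : realType.
Implicit Types (M N n x y z q r : nat) (al be ga : bool) (s t : nat * bool).

Local Notation zt := (@zeta_trunc R).
Local Notation ch := (@ch R).
Local Notation wt := (@wt R).
Local Notation conv11 := (@conv11 R).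

Lemma wt_ch s a n : wt s n * ch a n = wt (s.1, s.2 (+) a) n.
Proof. by rewrite /wt /= ch_addb; ring. Qed.

Lemma sum1_wt_zt M s t k : sum1 M (fun z => wt s z * zt z (t :: k)) =
  zt M (s :: t :: k) + zt M (emerge s t :: k).
Proof.
rewrite [zt M (s :: _)]zt_cons [zt M (emerge s t :: _)]zt_cons -sum1D.
by apply: eq_sum1 => z /andP[z0 _]; rewrite ztP // wt_emerge; ring.
Qed.

Lemma sum1_wt_conv11 M s al be : sum1 M (fun z => wt s z * conv11 z al be) =
  zt M [:: s; (1%N, al); (1%N, al (+) be)] +
  zt M [:: emerge s (1%N, al); (1%N, al (+) be)] +
  (zt M [:: s; (1%N, be); (1%N, al (+) be)] +
   zt M [:: emerge s (1%N, be); (1%N, al (+) be)]).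
Proof.
rewrite -!sum1_wt_zt -sum1D; apply: eq_sum1 => z _.
by rewrite conv11E mulrDr.
Qed.

Lemma conv11_pred al be z : (0 < z)%N ->
  sum1 z.-1 (fun p => wt (1%N, al) p * zt (z - p) [:: (1%N, be)]) = conv11 z al be.
Proof.
by case: z => // z _; rewrite /conv11 sum1S subnn zt_0 mulr0 addr0.
Qed.

Lemma sum1_top (f : nat -> R) p z : (0 < p <= z)%N ->
  sum1 p.-1 (fun y => f (z - y)%N) = sum1 z.-1 f - sum1 (z - p) f.
Proof.
move=> /andP[p0 pz]; rewrite (@sum1_split _ (z - p) z.-1); last by lia.
rewrite [X in X - _]addrC addrK (_ : z.-1 - (z - p) = p.-1)%N; last by lia.
by rewrite sum1_rev; apply: eq_sum1 => i /andP[i0 ip]; congr f; lia.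
Qed.

(** Put p = z - x and q = z - y. The condition x + y < z becomes p + q > z with p, q < z: a square,
    which the stuffle expands, minus the triangle p + q <= z, which is a Cauchy product. *)
Lemma partCE u al be ga M (ta := al (+) be (+) ga) : partC R u al be ga M =
  zt M [:: (u, ta); (1%N, al (+) be); (1%N, al (+) ga)] +
  zt M [:: (u, ta); (1%N, al (+) ga); (1%N, al (+) be)] +
  zt M [:: (u, ta); emerge (1%N, al (+) be) (1%N, al (+) ga)] -
  sum1 M (fun z => wt (u, ta) z * conv11 z (al (+) be) (al (+) ga)).
Proof.
rewrite 3!zt_cons -!sum1D -sum1B; apply: eq_sum1 => z /andP[z0 _].
rewrite -!mulrDr -mulrBr -stuffle11 -conv11_pred //.
transitivity (sum1 z.-1 (fun x => sum1 (z.-1 - x) (fun y =>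
    ch al (z - (x + y)) * ch be x * ch ga y *
    (z%:R ^- u / ((z%:R - x%:R) * (z%:R - y%:R)))))).
  rewrite -sum1_tri; apply: eq_sum1 => m /andP[m0 mz].
  apply: eq_sum1 => x /andP[x0 xm]; rewrite subnKC //; lia.
rewrite sum1_rev prednK // [in RHS]zt1 -sum1Mr -sum1B -sum1Ml.
apply: eq_sum1 => p /andP[p0 pz].
rewrite -mulrBr !zt1 -sum1_top; last by lia.
have -> : (z.-1 - (z - p) = p.-1)%N by lia.
rewrite -!sum1Ml; apply: eq_sum1 => y /andP[y0 yp].
have pz' : (p <= z)%N by lia.
have yz : (y <= z)%N by lia.
rewrite -!natrB //; last by lia.
rewrite subKn // (_ : z - (z - p + y) = p - y)%N; last by lia.
rewrite /wt /= !ch_addb !chB //; last by lia.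
rewrite invfM !expr1.
transitivity (ch al p * ch al y * ch be z * ch be p * ch ga y * z%:R ^- u / p%:R / (z - y)%:R).
  by ring.
transitivity ((ch al z * ch al z) * (ch ga z * ch ga z) * (ch al p * ch al y * ch be z * ch be p * ch ga y * z%:R ^- u / p%:R / (z - y)%:R)).
  by rewrite !ch_sqr !mul1r.
by ring.
Qed.

Definition convdef al ga M : R :=
  conv11 M al ga - zt M [:: (1%N, al)] * zt M [:: (1%N, ga)].

(** The contribution of r <= x to [convdef]; it has to be subtracted because r = x + j exceeds x in
    [innerE_high]. *)
Definition corner al ga M x : R := sum1 x (fun r => wt (1%N, al) r *
  (zt (M - r) [:: (1%N, ga)] - zt M [:: (1%N, ga)])).

Lemma corner_diag al ga M : corner al ga M M = convdef al ga M.
Proof.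
rewrite /corner /convdef /conv11 [zt M [:: (1%N, al)]]zt1 -sum1Mr -sum1B.
by apply: eq_sum1 => r _; rewrite mulrBr.
Qed.

Definition upper al ga M r : R := wt (1%N, al) r *
  ((1 - ch ga r) * zt M [:: (1%N, ga)] + ch ga r * zt r [:: (1%N, ga)]).

Lemma sum1_shift_zt (s : nat * bool) M y : (y <= M)%N ->
  sum1 (M - y) (fun i => wt s (y + i)) = zt M [:: s] - zt y [:: s].
Proof.
by move=> yM; rewrite !zt1 (@sum1_split _ y M) // [X in X - _]addrC addrK.
Qed.

Lemma innerE_exch al ga N x : innerE R al ga N x =
  sum1 N (fun y => ch (al (+) ga) y / (y%:R - x%:R) *
    (zt N [:: (1%N, al)] - zt y [:: (1%N, al)])).
Proof.
rewrite /innerE.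
under eq_fun do rewrite -sum1Ml.
rewrite sum1_exch; apply: eq_sum1 => y /andP[y0 yN].
by rewrite -sum1_shift_zt // -sum1Ml; apply: eq_sum1 => i _; rewrite mulrC.
Qed.

Lemma sum1_triC N (g : nat -> nat -> R) :
  sum1 N (fun i => sum1 (N - i) (fun j => g i j)) =
  sum1 N (fun j => sum1 (N - j) (fun i => g i j)).
Proof.
rewrite -sum1_tri -(sum1_tri N (fun j i => g i j)).
apply: eq_sum1 => m /andP[m0 _]; rewrite sum1_rev prednK //.
by apply: eq_sum1 => i /andP[i0 im]; rewrite subKn //; lia.
Qed.

(** The part y > x of [innerE]. With y = x + i, r = x + j and q = r + i, one has 1/(i(r + i)) =
    (1/r)(1/i - 1/(r + i)). The first fraction sums to the truncation at M - r; replacing it by the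
    one at M produces the defect minus the corner, and the rest is [upper]. *)
Lemma innerE_high al ga M x : (x <= M)%N ->
  sum1 (M - x) (fun i => wt (1%N, al (+) ga) i *
     (zt M [:: (1%N, al)] - zt (x + i) [:: (1%N, al)])) =
  sum1 (M - x) (fun j => upper al ga M (x + j)) +
  convdef al ga M - corner al ga M x.
Proof.
move=> xM.
transitivity (sum1 (M - x) (fun i => sum1 (M - x - i) (fun j =>
    wt (1%N, al (+) ga) i * wt (1%N, al) (x + j + i)))).
  apply: eq_sum1 => i /andP[i0 iM].
  rewrite -sum1_shift_zt; last by lia.
  rewrite -sum1Ml subnDA; apply: eq_sum1 => j _; congr (_ * wt _ _); lia.
rewrite sum1_triC -corner_diag.
rewrite /corner (@sum1_split _ x M) // [X in _ + X - _]addrC addrA addrK -sum1D.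
apply: eq_sum1 => j /andP[j0 jM].
pose r := (x + j)%N; rewrite -/r (_ : M - x - j = M - r)%N; last by rewrite /r; lia.
have rM : (r <= M)%N by rewrite /r; lia.
have r0 : (0 < r)%N by rewrite /r; lia.
clearbody r.
transitivity (wt (1%N, al) r * (sum1 (M - r) (wt (1%N, ga)) -
   ch ga r * sum1 (M - r) (fun i => wt (1%N, ga) (r + i)))); last first.
  by rewrite sum1_shift_zt // -zt1 /upper; ring.
rewrite -sum1Ml -sum1B -sum1Ml; apply: eq_sum1 => i /andP[i0 iM].
have i0R : i%:R != 0 :> R by rewrite pnatr_eq0 -lt0n.
have r0R : r%:R != 0 :> R by rewrite pnatr_eq0 -lt0n.
have ri0R : r%:R + i%:R != 0 :> R by rewrite -natrD pnatr_eq0 -lt0n addn_gt0 i0 orbT.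
rewrite /wt /= ch_addb !chD !expr1 natrD.
transitivity ((ch al i * ch al i) * (ch al r * ch ga i / (i%:R * (r%:R + i%:R)))).
  by rewrite invfM; ring.
rewrite ch_sqr mul1r.
transitivity (ch al r / r%:R * (ch ga i / i%:R - (ch ga r * ch ga r) * ch ga i / (r%:R + i%:R))).
  rewrite ch_sqr mul1r; field.
  by rewrite i0R r0R ri0R.
by ring.
Qed.

(** The part y < x is added: with y = x - i the kernel is -1/i, which gives a product of truncated
    sums minus a Cauchy product cut at x. The term y = x is 0. *)
Lemma innerE_full al ga M x : (0 < x <= M)%N ->
  innerE R al ga M x = ch (al (+) ga) x *
   (sum1 (M - x) (fun j => upper al ga M (x + j)) + convdef al ga M - corner al ga M x
    - (zt x.-1 [:: (1%N, al (+) ga)] * zt M [:: (1%N, al)] - conv11 x (al (+) ga) al)).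
Proof.
move=> /andP[x0 xM].
rewrite -innerE_high // innerE_exch (@sum1_split _ x M) //.
have -> : x = x.-1.+1 by rewrite prednK.
rewrite sum1S prednK // subrr invr0 mulr0 mul0r addr0 mulrBr addrC; congr (_ + _).
  rewrite -sum1Ml; apply: eq_sum1 => i /andP[i0 iM].
  by rewrite natrD (addrC x%:R) addrK /wt /= chD expr1; ring.
rewrite -conv11_pred // [zt x.-1 _]zt1 -sum1Mr -sum1B -mulrN -sum1N -sum1Ml.
rewrite sum1_rev prednK //; apply: eq_sum1 => i /andP[i0 iM].
have ix : (i <= x)%N by lia.
rewrite natrB // chB // /wt /= expr1.
have -> : x%:R - i%:R - x%:R = - i%:R :> R by ring.
by rewrite invrN; ring.
Qed.

Definition mainA u al be ga M : R := let ta := be (+) (al (+) ga) in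
  zt M [:: (1%N, ga)] * (zt M [:: (1%N, al); (u, ta)] - zt M [:: (1%N, al (+) ga); (u, ta)])
  + (zt M [:: (1%N, al (+) ga); (1%N, ga); (u, ta)] +
     zt M [:: (1%N, al (+) ga); (u, ta); (1%N, ga)] +
     zt M [:: (1%N, al (+) ga); emerge (1%N, ga) (u, ta)] +
     zt M [:: emerge (1%N, al (+) ga) (1%N, ga); (u, ta)])
  - zt M [:: (1%N, al)] * zt M [:: (u, ta); (1%N, al (+) ga)]
  + (zt M [:: (u, ta); (1%N, al (+) ga); (1%N, al (+) ga (+) al)] +
     zt M [:: emerge (u, ta) (1%N, al (+) ga); (1%N, al (+) ga (+) al)] +
    (zt M [:: (u, ta); (1%N, al); (1%N, al (+) ga (+) al)] +
     zt M [:: emerge (u, ta) (1%N, al); (1%N, al (+) ga (+) al)])).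

Lemma sum1_innerE u al be ga M (ta := be (+) (al (+) ga)) :
  sum1 M (fun x => wt (u, be) x * innerE R al ga M x) =
  mainA u al be ga M + convdef al ga M * zt M [:: (u, ta)]
  - sum1 M (fun x => wt (u, ta) x * corner al ga M x).
Proof.
transitivity (sum1 M (fun x => sum1 (M - x) (fun j => wt (u, ta) x * upper al ga M (x + j)))
  + sum1 M (fun x => convdef al ga M * wt (u, ta) x)
  - sum1 M (fun x => wt (u, ta) x * corner al ga M x)
  - (sum1 M (fun x => zt M [:: (1%N, al)] * (wt (u, ta) x * zt x.-1 [:: (1%N, al (+) ga)]))
     - sum1 M (fun x => wt (u, ta) x * conv11 x (al (+) ga) al))).
  rewrite -[X in _ - X]sum1B -sum1D -sum1B -sum1B; apply: eq_sum1 => x xM.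
  by rewrite innerE_full // mulrA wt_ch sum1Ml; ring.
rewrite -(sum1_exch M (fun r x => wt (u, ta) x * upper al ga M r)).
have -> : sum1 M (fun r => sum1 r.-1 (fun x => wt (u, ta) x * upper al ga M r)) =
  zt M [:: (1%N, ga)] * (zt M [:: (1%N, al); (u, ta)] - zt M [:: (1%N, al (+) ga); (u, ta)])
  + (zt M [:: (1%N, al (+) ga); (1%N, ga); (u, ta)] +
     zt M [:: (1%N, al (+) ga); (u, ta); (1%N, ga)] +
     zt M [:: (1%N, al (+) ga); emerge (1%N, ga) (u, ta)] +
     zt M [:: emerge (1%N, al (+) ga) (1%N, ga); (u, ta)]).
  rewrite ![zt M [:: _, _ & _]]zt_cons -!sum1D -sum1B -sum1Ml -sum1D.
  apply: eq_sum1 => r /andP[r0 _]; rewrite sum1Mr -zt1 -!mulrDr -stuffle11 wt_emerge.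
  rewrite /upper (@ztP R r) // zt_nil mulr1 -(wt_ch (1%N, al) ga) /=.
  by ring.
rewrite !sum1Ml -zt1 sum1_wt_conv11 -(zt_cons R M (u, ta)) /mainA.
by ring.
Qed.

(** This is [partD] with q running up to M instead of M - x, as [mainDE] shows. *)
Definition mainD u al be ga M : R :=
  u%:R * zt M [:: (1%N, al); (u.+1, al (+) be (+) ga)] -
  zt M [:: (2%N, al); (u, al (+) be (+) ga)].

Lemma mainDE u al be ga M : mainD u al be ga M =
  sum1 M (fun x => sum1 M (fun q => if (x < q)%N then
    ch al (q - x) * ch (be (+) ga) x *
     (u%:R * x%:R ^- u.+1 / q%:R - x%:R ^- u / q%:R ^+ 2) else 0)).
Proof.
rewrite /mainD sum1_swap !zt_cons -sum1Ml -sum1B; apply: eq_sum1 => q /andP[q0 qM].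
rewrite (@sum1_split _ q.-1 M); last by lia.
rewrite [X in _ = _ + X]sum1_eq0 ?addr0; last by move=> i /andP[i0 iM]; rewrite ifF //; lia.
rewrite !zt1 -!sum1Ml -sum1B; apply: eq_sum1 => x /andP[x0 xq].
rewrite ifT; last by lia.
by rewrite /wt /= !ch_addb chB ?expr1; [ring | lia].
Qed.

End Parts.

(** * Estimates *)

Section Estimates.
Variable R : realType.
Implicit Types (M N n x y z q r : nat) (al be ga : bool) (s t : nat * bool).
Implicit Types (f g : nat -> R).

Local Notation zt := (@zeta_trunc R).
Local Notation ch := (@ch R).
Local Notation wt := (@wt R).
Local Notation conv11 := (@conv11 R).

(** The shift to n + 1 keeps bounds of the form C / [sq n] meaningful at n = 0. *)
Definition sq n : R := Num.sqrt n.+1%:R.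

Lemma sq_sqr n : sq n ^+ 2 = n.+1%:R.
Proof. by rewrite sqr_sqrtr. Qed.

Lemma sq_gt0 n : 0 < sq n.
Proof. by rewrite sqrtr_gt0. Qed.

Lemma sq_ge1 n : 1 <= sq n.
Proof. by rewrite -sqrtr1 ler_sqrt // ler1n. Qed.

Lemma sq_le m n : (m <= n)%N -> sq m <= sq n.
Proof. by move=> mn; rewrite ler_sqrt // ler_nat. Qed.

Definition Osq f : Prop := exists C : R, forall n, `|f n| <= C / sq n.

Lemma eq_Osq f g : f =1 g -> Osq f -> Osq g.
Proof. by move=> fg [C fC]; exists C => n; rewrite -fg. Qed.

Lemma Osq0 : Osq (fun=> 0).
Proof. by exists 0 => n; rewrite normr0 mul0r. Qed.

Lemma OsqD f g : Osq f -> Osq g -> Osq (fun n => f n + g n).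
Proof.
move=> [C fC] [D gD]; exists (C + D) => n.
by rewrite mulrDl (le_trans (ler_normD _ _)) // lerD.
Qed.

Lemma OsqN f : Osq f -> Osq (fun n => - f n).
Proof. by move=> [C fC]; exists C => n; rewrite normrN. Qed.

Lemma OsqB f g : Osq f -> Osq g -> Osq (fun n => f n - g n).
Proof. by move=> fO gO; apply: OsqD => //; apply: OsqN. Qed.

Lemma OsqMb f g (D : R) : (forall n, `|g n| <= D) -> Osq f -> Osq (fun n => f n * g n).
Proof.
move=> gD [C fC]; exists (C * D) => n.
by rewrite normrM mulrAC ler_pM.
Qed.

Lemma OsqZ (c : R) f : Osq f -> Osq (fun n => c * f n).
Proof.
move=> fO; apply: (@eq_Osq (fun n => f n * c)); first by move=> n; rewrite mulrC.
exact: (@OsqMb _ _ `|c|).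
Qed.

Lemma Osq_bounded f : Osq f -> exists D, forall n, `|f n| <= D.
Proof.
move=> [C fC]; exists `|C| => n; apply: (le_trans (fC n)).
rewrite ler_pdivrMr ?sq_gt0 //; apply: (le_trans (ler_norm C)).
by rewrite ler_peMr // sq_ge1.
Qed.

Lemma OsqM f g (a b : R) : Osq (fun n => f n - a) -> Osq (fun n => g n - b) ->
  Osq (fun n => f n * g n - a * b).
Proof.
move=> fa gb; have [D gD] := Osq_bounded gb.
apply: (@eq_Osq (fun n => (f n - a) * (g n - b) + (b * (f n - a) + a * (g n - b)))).
  by move=> n; ring.
apply: OsqD; first exact: (@OsqMb _ _ D).
by apply: OsqD; apply: OsqZ.
Qed.

Lemma Osq_cvg f : Osq f -> (f n @[n --> \oo] --> 0)%classic.
Proof.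
move=> [C fC]; apply/cvgr0Pnorm_lt => e e0.
near=> n; apply: (le_lt_trans (fC n)); rewrite ltr_pdivrMr ?sq_gt0 //.
have [C0|C0] := lerP C 0; first by rewrite (le_lt_trans C0) // mulr_gt0 // sq_gt0.
rewrite mulrC -ltr_pdivrMr // -[X in X < _]ger0_norm ?divr_ge0 ?ltW // -sqrtr_sqr.
rewrite ltr_sqrt //.
near: n; exists (Num.truncn ((C / e) ^+ 2)).+1 => //= n /= Hn.
have H0 : 0 <= (C / e) ^+ 2 by rewrite sqr_ge0.
have /andP[_ H] := truncn_itv H0.
by rewrite (lt_le_trans H) // ler_nat (leq_trans Hn).
Unshelve. all: by end_near. Qed.

(** A telescoping majorant of n^(-3/2). For consecutive roots s < t, 1/s - 1/t = 1/(st(s + t)), and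
    t <= 3s/2 bounds t(s + t) by 15/4 of s^2, whence the constant 4. *)
Lemma sq_telescope n : (n.+1%:R * sq n)^-1 <= 4 * ((sq n)^-1 - (sq n.+1)^-1).
Proof.
have s1 := sq_ge1 n; have s2 := sq_sqr n; have t2 := sq_sqr n.+1.
have t1 := sq_gt0 n.+1.
rewrite -s2; move: s1 s2 t1 t2; move: (sq n) (sq n.+1) => s t s1 s2 t1 t2.
have ts : t ^+ 2 = s ^+ 2 + 1 by rewrite t2 s2 -natr1.
have s0 : 0 < s by lra.
have t15 : t <= 3 / 2 * s.
  by rewrite -(@ler_pXn2r _ 2) // ?nnegrE ?ltW //; [rewrite ts; nra | lra].
rewrite -subr_ge0 (_ : _ - _ = (4 * s ^+ 2 * (t - s) - t) / (s ^+ 3 * t)); last first.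
  by field; rewrite !gt_eqF.
rewrite divr_ge0 //; last by rewrite mulr_ge0 ?exprn_ge0 // ltW.
have st0 : 0 < s + t by lra.
have -> : t - s = (s + t)^-1.
  apply: (@mulIf _ (s + t)); rewrite ?gt_eqF // mulVf ?gt_eqF //.
  by transitivity (t ^+ 2 - s ^+ 2); [ring | rewrite ts; ring].
rewrite subr_ge0 ler_pdivlMr //; nra.
Qed.

(* e bounds all the oscillation after n, so the limit is squeezed between
   the monotone sequences b - e and b + e *)
Lemma squeeze_limit (b e : nat -> R) : (forall n, 0 <= e n) ->
  (forall n, `|b n.+1 - b n| <= e n - e n.+1) ->
  exists L, forall n, `|b n - L| <= e n.
Proof.
move=> e0 be.
have step n m : `|b (n + m)%N - b n| <= e n - e (n + m)%N.
  elim: m => [|m IH]; first by rewrite addn0 !subrr normr0.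
  rewrite addnS; have := be (n + m)%N; move: IH; rewrite !ler_norml => /andP[? ?] /andP[? ?].
  by apply/andP; split; lra.
have cmp n m : `|b m - b n| <= e n + e m.
  have [nm|mn] := leqP n m.
    by rewrite -(subnKC nm); have := step n (m - n)%N; have := e0 (n + (m - n))%N; lra.
  have := step m (n - m)%N; rewrite subnKC ?(ltnW mn) // distrC.
  by have := e0 n; lra.
pose S := [set x | exists n, x = b n - e n]%classic.
have S0 : (S !=set0)%classic by exists (b 0%N - e 0%N), 0%N.
have ubS n : ubound S (b n + e n).
  move=> _ [m ->]; have := cmp n m; rewrite ler_norml => /andP[? ?]; lra.
exists (sup S) => n; rewrite ler_norml; apply/andP; split.
  have : sup S <= b n + e n by apply: ge_sup => //; exact: ubS.
  lra.
have : b n - e n <= sup S by apply: ub_le_sup; [exists (b 0%N + e 0%N); exact: ubS | exists n].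
lra.
Qed.

Lemma summable_Osq f (C : R) :
  (forall n, `|f n.+1| <= C / (n.+1%:R * sq n)) ->
  exists L, Osq (fun n => sum1 n f - L).
Proof.
move=> fC; have C0 : 0 <= C.
  have := le_trans (normr_ge0 _) (fC 0%N).
  by rewrite pmulr_lge0 // invr_gt0 mulr_gt0 // sq_gt0.
have [|n|L bL] := @squeeze_limit (fun n => sum1 n f) (fun n => 4 * C / sq n).
- by move=> n; rewrite divr_ge0 ?mulr_ge0 // ltW // sq_gt0.
- rewrite sum1S [X in X - _]addrC addrK (le_trans (fC n)) //.
  by rewrite -mulrBr -mulrA mulrCA ler_wpM2l // sq_telescope.
by exists L, (4 * C).
Qed.

Definition harm n : R := zt n [:: (1%N, false)].

Lemma wt1 n : wt (1%N, false) n = n%:R^-1.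
Proof. by rewrite /wt /= ch_false mul1r expr1. Qed.

Lemma harmE n : harm n = sum1 n (fun i => i%:R^-1).
Proof. by rewrite /harm zt1; apply: eq_sum1 => i _; rewrite wt1. Qed.

Lemma harmS n : harm n.+1 = harm n + n.+1%:R^-1.
Proof. by rewrite !harmE sum1S. Qed.

Lemma harm0 : harm 0 = 0. Proof. by rewrite harmE sum1_0. Qed.

Lemma harm_le m n : (m <= n)%N -> harm m <= harm n.
Proof.
move=> /subnKC <-; elim: (n - m)%N => [|k IH]; first by rewrite addn0.
by rewrite addnS harmS (le_trans IH) // lerDl.
Qed.

Lemma harm_ge0 n : 0 <= harm n.
Proof. by rewrite -harm0 harm_le. Qed.

(** The fourth root is chosen so that H_n^2 is O(sqrt n). For fourth roots y, x of n + 1 and n + 2,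
    1 = x^4 - y^4 = (x - y) B with B <= 8 y^3, because x <= 5y/4; hence the increment 1/(n + 1) is
    at most 8(x - y). *)
Lemma harm_root n : harm n <= 8 * Num.sqrt (sq n).
Proof.
elim: n => [|n IH]; first by rewrite harm0 mulr_ge0.
rewrite harmS (le_trans (lerD IH (lexx _))) //.
have y2 : Num.sqrt (sq n) ^+ 2 = sq n by rewrite sqr_sqrtr // ltW // sq_gt0.
have x2 : Num.sqrt (sq n.+1) ^+ 2 = sq n.+1 by rewrite sqr_sqrtr // ltW // sq_gt0.
have sqrt1 m : 1 <= Num.sqrt (sq m) by rewrite -sqrtr1 ler_wsqrtr // sq_ge1.
have [y1 x1] := (sqrt1 n, sqrt1 n.+1).
have -> : n.+1%:R = Num.sqrt (sq n) ^+ 2 ^+ 2 :> R by rewrite y2 sq_sqr.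
have xy : Num.sqrt (sq n.+1) ^+ 4 = Num.sqrt (sq n) ^+ 4 + 1.
  by rewrite !(exprM _ 2 2) x2 y2 !sq_sqr -natr1.
move: y1 x1 xy; move: (Num.sqrt (sq n)) (Num.sqrt (sq n.+1)) => {n IH y2 x2} y x y1 x1 xy.
have y0 : 0 < y by lra.
have y4 : 1 <= y ^+ 4 by rewrite exprn_ege1.
have x54 : x <= 5 / 4 * y.
  rewrite -(@ler_pXn2r _ 4) // ?nnegrE; [|lra|lra].
  by rewrite xy exprMn; lra.
have E : (x - y) * (x ^+ 3 + x ^+ 2 * y + x * y ^+ 2 + y ^+ 3) = 1.
  by transitivity (x ^+ 4 - y ^+ 4); [ring | rewrite xy; ring].
have xy' : y <= x by rewrite -(@ler_pXn2r _ 4) // ?nnegrE; lra.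
have y3 : 0 < y ^+ 3 by rewrite exprn_gt0.
have B : x ^+ 3 + x ^+ 2 * y + x * y ^+ 2 + y ^+ 3 <= 8 * y ^+ 3.
  have -> : 8 * y ^+ 3 = 2 * y ^+ 3 + 2 * y ^+ 2 * y + 2 * y * y ^+ 2 + 2 * y ^+ 3 by ring.
  have h2 : x ^+ 2 <= 2 * y ^+ 2 by nra.
  have h3 : x ^+ 3 <= 2 * y ^+ 3.
    have -> : 2 * y ^+ 3 = 2 * y * y ^+ 2 by ring.
    by rewrite exprS; nra.
  by apply: lerD; [apply: lerD; [apply: lerD|]|]; nra.
have : (y ^+ 2 ^+ 2)^-1 <= 8 * (x - y).
  rewrite -exprM -div1r ler_pdivrMr ?exprn_gt0 // exprSr.
  have : 1 <= (x - y) * (8 * y ^+ 3) by rewrite -{1}E ler_wpM2l // subr_ge0.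
  have : 0 <= (x - y) * (8 * y ^+ 3) by rewrite mulr_ge0 ?subr_ge0 //; lra.
  nra.
lra.
Qed.

Lemma harm_sqr n : harm n ^+ 2 <= 64 * sq n.
Proof.
have -> : 64 * sq n = (8 * Num.sqrt (sq n)) ^+ 2.
  by rewrite exprMn sqr_sqrtr ?ltW ?sq_gt0 //; ring.
by rewrite ler_pXn2r ?nnegrE ?harm_ge0 ?harm_root // mulr_ge0.
Qed.

Lemma harm_sq n : harm n <= 64 * sq n.
Proof.
have := harm_sqr n; have := harm_ge0 n; have := sq_ge1 n.
move: (sq n) (harm n) => s h s1 h0 hs.
have [h1|h1] := lerP h 1; first by lra.
by apply: le_trans hs; nra.
Qed.

End Estimates.

(** * Bounds for the corners and for the Cauchy defect *)

Section Remainders.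
Variable R : realType.
Implicit Types (M N n x y z q r : nat) (al be ga : bool) (s t : nat * bool).
Implicit Types (f g : nat -> R).

Local Notation zt := (@zeta_trunc R).
Local Notation ch := (@ch R).
Local Notation wt := (@wt R).
Local Notation conv11 := (@conv11 R).
Local Notation harm := (@harm R).
Local Notation sq := (@sq R).

Lemma ler_sum1 N f g : (forall i, (0 < i <= N)%N -> f i <= g i) -> sum1 N f <= sum1 N g.
Proof. by move=> fg; rewrite /sum1 !big_nat; apply: ler_sum => i /fg. Qed.

Lemma norm_sum1 N f : `|sum1 N f| <= sum1 N (fun i => `|f i|).
Proof. exact: ler_norm_sum. Qed.

Lemma norm_wt s n : `|wt s n| = n%:R ^- s.1.
Proof. by rewrite /wt normrM norm_ch mul1r normfV normrX normr_nat. Qed.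

Lemma ler_natXV (d e n : nat) : (d <= e)%N -> (0 < n)%N -> n%:R ^- e <= n%:R ^- d :> R.
Proof.
by move=> de n0; rewrite lef_pV2 ?posrE ?exprn_gt0 ?ltr0n // ler_weXn2l // ler1n.
Qed.

Lemma norm_wt1 s n : (0 < s.1)%N -> (0 < n)%N -> `|wt s n| <= n%:R^-1.
Proof. by move=> s0 n0; rewrite norm_wt -[X in _ <= X^-1]expr1 ler_natXV. Qed.

Lemma harm_ge1 n : (0 < n)%N -> 1 <= harm n.
Proof.
by move=> n0; have := harm_le R n0; rewrite [X in X <= _]harmS harm0 add0r invr1.
Qed.

Lemma harm_diffE M x : (x <= M)%N ->
  harm M - harm (M - x) = sum1 x (fun i => (M - x + i)%:R^-1).
Proof.
move=> xM; rewrite !harmE (@sum1_split _ (M - x) M) ?leq_subr // addrC addKr.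
by rewrite subKn.
Qed.

Lemma harm_diff M x : (x <= M)%N ->
  harm M - harm (M - x) <= x%:R / (M.+1 - x)%:R.
Proof.
move=> xM; rewrite harm_diffE //.
apply: (@le_trans _ _ (sum1 x (fun=> (M.+1 - x)%:R^-1))).
  apply: ler_sum1 => i /andP[i0 ix].
  by rewrite lef_pV2 ?posrE ?ltr0n ?ler_nat; lia.
by rewrite /sum1 big_const_nat iter_addr_0 subn1 /= mulr_natl.
Qed.

Lemma sum1_inv_conv M :
  sum1 M (fun r => r%:R^-1 * (M.+1 - r)%:R^-1) = 2 * harm M / M.+1%:R :> R.
Proof.
transitivity (sum1 M (fun r => (r%:R^-1 + (M.+1 - r)%:R^-1) / M.+1%:R) : R).
  apply: eq_sum1 => r /andP[r0 rM].
  have E : r%:R + (M.+1 - r)%:R = M.+1%:R :> R by rewrite -natrD subnKC // ltnW.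
  have r0R : r%:R != 0 :> R by rewrite pnatr_eq0 -lt0n.
  have s0R : (M.+1 - r)%:R != 0 :> R by rewrite pnatr_eq0 -lt0n subn_gt0.
  have M0R : M.+1%:R != 0 :> R by rewrite pnatr_eq0.
  move: E r0R s0R M0R; move: (r%:R : R) (M.+1%:R : R) ((M.+1 - r)%:R : R).
  by move=> X Y Z <- X0 Z0 XZ0; field; rewrite X0 XZ0 Z0.
by rewrite sum1Mr sum1D -(sum1_rev M (fun r => r%:R^-1)) -harmE; ring.
Qed.

(** By [harm_diff] one factor x cancels, and each summand is at most 1/(x(M + 1 - x)), whose sum is
    known by partial fractions. *)
Lemma sum1_corner M :
  sum1 M (fun x => x%:R ^- 2 * (harm M - harm (M - x))) <= 2 * harm M / M.+1%:R.
Proof.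
rewrite -sum1_inv_conv; apply: ler_sum1 => x /andP[x0 xM].
have x0R : x%:R != 0 :> R by rewrite pnatr_eq0 -lt0n.
have -> : x%:R^-1 = x%:R ^- 2 * x%:R :> R by field.
by rewrite -mulrA ler_wpM2l ?invr_ge0 ?exprn_ge0 // harm_diff.
Qed.

Lemma Osq_harm_sqr : Osq (fun M => harm M ^+ 2 / M.+1%:R).
Proof.
exists 64 => n; rewrite ger0_norm ?divr_ge0 ?exprn_ge0 ?harm_ge0 //.
have -> : n.+1%:R = sq n * sq n by rewrite -expr2 sq_sqr.
rewrite ler_pdivrMr ?mulr_gt0 ?sq_gt0 // mulrA divfK ?gt_eqF ?sq_gt0 //.
exact: harm_sqr.
Qed.

Lemma Osq_harm : Osq (fun M => harm M / M.+1%:R).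
Proof.
have [C HC] := Osq_harm_sqr; exists C => n; apply: le_trans (HC n).
case: n => [|n]; first by rewrite harm0 expr0n /= !mul0r.
rewrite !ger0_norm ?divr_ge0 ?sqr_ge0 ?harm_ge0 // ler_wpM2r ?invr_ge0 //.
by rewrite expr2 ler_peMr ?harm_ge0 // harm_ge1.
Qed.

Lemma Osq_le f g : (forall n, `|f n| <= `|g n|) -> Osq g -> Osq f.
Proof. by move=> fg [C gC]; exists C => n; apply: le_trans (gC n). Qed.

(** The common estimate for every discarded corner: since u >= 2, the sum is at most 2 C H_M^2/(M +
    1). *)
Lemma Osq_corner u be (C : R) (F : nat -> nat -> R) : (1 < u)%N -> 0 <= C ->
  (forall M x, (0 < x <= M)%N -> `|F M x| <= C * harm M * (harm M - harm (M - x))) ->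
  Osq (fun M => sum1 M (fun x => wt (u, be) x * F M x)).
Proof.
move=> u1 C0 FC; apply: (@Osq_le _ (fun M => 2 * C * (harm M ^+ 2 / M.+1%:R))).
  move=> M; apply: (le_trans (norm_sum1 _ _)).
  apply: (@le_trans _ _ (sum1 M (fun x => C * harm M *
      (x%:R ^- 2 * (harm M - harm (M - x)))))).
    apply: ler_sum1 => x xM; rewrite normrM mulrCA ler_pM // ?FC //.
    by rewrite norm_wt ler_natXV //; case/andP: xM.
  rewrite sum1Ml ger0_norm; last by rewrite !mulr_ge0 ?invr_ge0 ?exprn_ge0 ?harm_ge0.
  apply: (le_trans (ler_wpM2l _ (sum1_corner M))); first by rewrite mulr_ge0 ?harm_ge0.
  by rewrite le_eqVlt; apply/orP; left; apply/eqP; ring.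
by apply: OsqZ; exact: Osq_harm_sqr.
Qed.

(** Each distance |y - x| occurs at most twice, once on either side of x, and the term y = x is
    0. *)
Lemma norm_kernel al N M x : (N <= M)%N -> (0 < x <= M)%N ->
  `|sum1 N (fun y => ch al y / (y%:R - x%:R))| <= 2 * harm M.
Proof.
move=> NM /andP[x0 xM]; apply: (le_trans (norm_sum1 _ _)).
apply: (@le_trans _ _ (sum1 M (fun y => `|(y%:R - x%:R)^-1|))).
  rewrite (@sum1_split _ N M) // -[X in X <= _]addr0; apply: lerD.
    by apply: ler_sum1 => y _; rewrite normrM norm_ch mul1r.
  by apply: sumr_ge0.
rewrite (@sum1_split _ x M) // mulr_natl mulr2n; apply: lerD; last first.
  apply: (@le_trans _ _ (harm (M - x))); last by rewrite harm_le // leq_subr.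
  rewrite harmE; apply: ler_sum1 => i _.
  by rewrite natrD (addrC x%:R) addrK ger0_norm.
have -> : x = x.-1.+1 by rewrite prednK.
rewrite sum1S prednK // subrr invr0 normr0 addr0.
apply: (@le_trans _ _ (harm x.-1)); last by rewrite harm_le //; lia.
rewrite harmE sum1_rev prednK //; apply: ler_sum1 => i /andP[i0 ix].
rewrite natrB; last by lia.
have -> : x%:R - i%:R - x%:R = - i%:R :> R by ring.
by rewrite invrN normrN ger0_norm.
Qed.

(** Each q in (M - x, M] that is added costs at most 2 H_M/q by [norm_kernel], which is the shape
    required by [Osq_corner]. *)
Lemma Osq_partA u al be ga : (1 < u)%N ->
  Osq (fun M => partA R u al be ga M - sum1 M (fun x => wt (u, be) x * innerE R al ga M x)).
Proof.
move=> u1.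
pose F M x : R := innerE R al ga (M - x) x - innerE R al ga M x.
apply: (@eq_Osq _ (fun M => sum1 M (fun x => wt (u, be) x * F M x))).
  by move=> M; rewrite /partA -sum1B; apply: eq_sum1 => x _; rewrite mulrBr.
apply: (@Osq_corner _ _ 2) => // M x /andP[x0 xM].
rewrite /F distrC /innerE (@sum1_split _ (M - x) M) ?leq_subr // addrC addKr subKn //.
apply: (le_trans (norm_sum1 _ _)); rewrite harm_diffE // -sum1Ml.
apply: ler_sum1 => i /andP[i0 ix]; rewrite normrM mulrC ler_pM //.
  by apply: norm_kernel; [lia | rewrite x0].
by rewrite norm_wt1 //; lia.
Qed.

Lemma zt1_diff s M r : (0 < s.1)%N -> (r <= M)%N ->
  `|zt M [:: s] - zt (M - r) [:: s]| <= harm M - harm (M - r).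
Proof.
move=> s0 rM; rewrite -sum1_shift_zt ?leq_subr // subKn // harm_diffE //.
apply: (le_trans (norm_sum1 _ _)); apply: ler_sum1 => i /andP[i0 ix].
by rewrite norm_wt1 //; lia.
Qed.

Lemma Osq_sum_corner u al ga be : (1 < u)%N ->
  Osq (fun M => sum1 M (fun x => wt (u, be) x * corner R al ga M x)).
Proof.
move=> u1; apply: (@Osq_corner _ _ 1) => // M x /andP[x0 xM]; rewrite mul1r.
apply: (@le_trans _ _ (harm x * (harm M - harm (M - x)))); last first.
  by rewrite ler_wpM2r ?harm_le // subr_ge0 harm_le // leq_subr.
rewrite [harm x]harmE -sum1Mr; apply: (le_trans (norm_sum1 _ _)).
apply: ler_sum1 => r /andP[r0 rx]; rewrite normrM ler_pM ?norm_wt1 // distrC.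
apply: (le_trans (zt1_diff _ _)) => //; first by lia.
by rewrite lerD2l lerN2 harm_le //; lia.
Qed.

Lemma Osq_partD u al be ga : (1 < u)%N ->
  Osq (fun M => partD R u al be ga M - mainD R u al be ga M).
Proof.
move=> u1.
(* One factor 1/x of x^-(u+1) is moved into [d], so that both terms share the weight x^-u; what
   remains is at most (u + 1)/q. *)
pose d x q : R := if (x < q)%N then ch al (q - x) * ch (be (+) ga) x *
     (u%:R / x%:R / q%:R - 1 / q%:R ^+ 2) else 0.
pose F M x : R := - sum1 x (fun i => d x (M - x + i)%N).
apply: (@eq_Osq _ (fun M => sum1 M (fun x => wt (u, false) x * F M x))).
  move=> M; rewrite mainDE /partD -sum1B; apply: eq_sum1 => x /andP[x0 xM].
  rewrite [X in _ - X](@sum1_split _ (M - x)) ?leq_subr // opprD addrA subrr add0r.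
  rewrite subKn // /F mulrN -sum1Ml; congr (- _); apply: eq_sum1 => i _.
  rewrite /d; case: ifP => _; last by rewrite mulr0.
  by rewrite /wt /= ch_false mul1r [x%:R ^+ u.+1]exprS [(x%:R * _)^-1]invfM; ring.
apply: (@Osq_corner _ _ (u%:R + 1)) => // M x /andP[x0 xM].
apply: (@le_trans _ _ ((u%:R + 1) * 1 * (harm M - harm (M - x)))); last first.
  rewrite ler_wpM2r ?subr_ge0 ?harm_le ?leq_subr // ler_wpM2l //.
  by rewrite harm_ge1 // (leq_trans x0).
rewrite mulr1 /F normrN harm_diffE // -sum1Ml; apply: (le_trans (norm_sum1 _ _)).
apply: ler_sum1 => i /andP[i0 ix]; rewrite /d; set q := (M - x + i)%N.
have q0 : (0 < q)%N by rewrite /q; lia.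
case: ifP => _; last by rewrite normr0 mulr_ge0 // addr_ge0.
rewrite !normrM !norm_ch !mul1r (le_trans (ler_normB _ _)) // mulrDl mul1r.
rewrite lerD // ?ger0_norm ?mulr_ge0 ?invr_ge0 ?exprn_ge0 //.
  rewrite ler_wpM2r // ler_pdivrMr ?ltr0n // ler_peMr // ler1n //.
by rewrite -[X in _ <= X^-1]expr1 ler_natXV.
Qed.

Lemma alternating_bound (f : nat -> R) n :
  (forall i, 0 <= f i.+1 <= f i) -> 0 <= \sum_(0 <= i < n) (-1) ^+ i * f i <= f 0%N.
Proof.
elim: n f => [|n IH] f fdec.
  by rewrite big_geq // lexx; have /andP[? ?] := fdec 0%N; rewrite (le_trans _ (_ : f 1%N <= _)).
rewrite big_nat_recl // expr0 mul1r.
have -> : \sum_(0 <= i < n) (-1) ^+ i.+1 * f i.+1 = - \sum_(0 <= i < n) (-1) ^+ i * f i.+1.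
  by rewrite -sumrN; apply: eq_bigr => i _; rewrite exprS; ring.
have /andP[H1 H2] := IH (fun i => f i.+1) (fun i => fdec i.+1).
by have /andP[H3 H4] := fdec 0%N; apply/andP; split; lra.
Qed.

Lemma zt1_alt_diff M r : (0 < r <= M)%N ->
  `|zt M [:: (1%N, true)] - zt (M - r) [:: (1%N, true)]| <= (M.+1 - r)%:R^-1.
Proof.
move=> /andP[r0 rM]; rewrite -sum1_shift_zt ?leq_subr // subKn //.
have -> : sum1 r (fun i => wt (1%N, true) (M - r + i)) =
  ch true (M - r).+1 * \sum_(0 <= i < r) (-1) ^+ i * (M.+1 - r + i)%:R^-1.
  rewrite /sum1 big_add1 mulr_sumr; apply: eq_bigr => i _.
  rewrite /wt /= expr1 addnS -addSn chD -subSn // /ch /=; ring.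
rewrite normrM norm_ch mul1r.
pose f i : R := (M.+1 - r + i)%:R^-1.
have fdec i : 0 <= f i.+1 <= f i.
  by rewrite invr_ge0 ler0n /= lef_pV2 ?posrE ?ltr0n ?ler_nat; lia.
have /andP[H1 H2] := alternating_bound r fdec.
by rewrite ger0_norm // (le_trans H2) // /f addn0.
Qed.

Lemma conv11C M al be : conv11 M al be = conv11 M be al.
Proof. by rewrite !conv11E addrC (addbC al). Qed.

Lemma convdefC M al be : convdef R al be M = convdef R be al M.
Proof. by rewrite /convdef conv11C mulrC. Qed.

(** The Cauchy product and the stuffle product both contain 2 ζ^(M)(1,1); only the stuffle diagonal
    survives, so this defect does not vanish in the limit. *)
Lemma convdef_ff M : convdef R false false M = - zt M [:: (2%N, false)].
Proof. by rewrite /convdef conv11E stuffle11; ring. Qed.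

(** The tail of an alternating sum is bounded by its first term 1/(M + 1 - r), so the defect is at
    most the sum of 1/(r(M + 1 - r)), that is 2 H_M/(M + 1). *)
Lemma Osq_convdef_alt al : Osq (convdef R al true).
Proof.
apply: (@Osq_le _ (fun M => 2 * (harm M / M.+1%:R))); last first.
  by apply: OsqZ; exact: Osq_harm.
move=> M; rewrite -corner_diag /corner.
rewrite [X in _ <= X]ger0_norm; last by rewrite !mulr_ge0 ?invr_ge0 ?harm_ge0.
rewrite mulrA -sum1_inv_conv; apply: (le_trans (norm_sum1 _ _)).
apply: ler_sum1 => r /andP[r0 rM]; rewrite normrM ler_pM ?norm_wt1 // distrC.
by rewrite zt1_alt_diff // r0.
Qed.

Lemma Osq_convdef al be : al || be -> Osq (convdef R al be).
Proof.
case: be; first by move=> _; exact: Osq_convdef_alt.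
case: al => // _; apply: (@eq_Osq _ (convdef R false true)); last exact: Osq_convdef_alt.
by move=> M; rewrite convdefC.
Qed.

End Remainders.

(** * Asymptotic expansions and the stuffle regularization *)

Section Expansions.
Local Open Scope classical_set_scope.
Local Open Scope ring_scope.
Variable R : realType.
Implicit Types (M N n x y z q r : nat) (al be ga : bool) (s t : nat * bool).
Implicit Types (f g : nat -> R) (k : eindex) (P Q : {poly R}).

Local Notation zt := (@zeta_trunc R).
Local Notation ch := (@ch R).
Local Notation wt := (@wt R).
Local Notation harm := (@harm R).
Local Notation sq := (@sq R).

Definition posidx k := all (fun s : nat * bool => 0 < s.1)%N k.

Lemma zt_growth k n : posidx k -> `|zt n k| <= harm n ^+ size k.
Proof.
elim: k n => [|s k IH] n /=; first by rewrite zt_nil normr1.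
move=> /andP[s0 kpos]; rewrite zt_cons exprS harmE -sum1Mr -harmE.
apply: (le_trans (norm_sum1 _ _)); apply: ler_sum1 => i /andP[i0 iN].
rewrite normrM ler_pM ?norm_wt1 // (le_trans (IH _ kpos)) //.
by rewrite lerXn2r ?nnegrE ?harm_ge0 // harm_le //; lia.
Qed.

Lemma zt_sq k n : posidx k -> (size k <= 2)%N -> `|zt n k| <= 64 * sq n.
Proof.
move=> /(zt_growth n); case: k => [|s [|t [|r k]]] //= H _; apply: (le_trans H).
- by have := sq_ge1 R n; rewrite expr0; lra.
- exact: harm_sq.
- exact: harm_sqr.
Qed.

Lemma natrSV_sq n : (n.+1%:R * sq n)^-1 = n.+1%:R ^- 2 * sq n.
Proof.
rewrite -sq_sqr; have := sq_gt0 R n; move: (sq n) => a a0.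
by field; rewrite gt_eqF.
Qed.

Lemma zt_cvg_ge2 s k : (1 < s.1)%N -> posidx k -> (size k <= 2)%N ->
  exists L, Osq (fun n => zt n (s :: k) - L).
Proof.
move=> s1 kpos k2.
have [|L HL] := @summable_Osq R (fun n => wt s n * zt n.-1 k) 64.
  move=> n; rewrite natrSV_sq mulrCA normrM ler_pM ?zt_sq //.
  by rewrite norm_wt ler_natXV.
by exists L; apply: eq_Osq HL => n; rewrite zt_cons.
Qed.

Lemma zt_step k n : posidx k -> (size k <= 2)%N -> (0 < n)%N ->
  `|zt n k - zt n.-1 k| <= 64 * sq n / n%:R.
Proof.
case: k => [|s k] /=.
  by rewrite !zt_nil subrr normr0 => *; rewrite divr_ge0 ?mulr_ge0 // ltW // sq_gt0.
move=> /andP[s0 kpos] k2 n0; rewrite ztP // addrC addKr normrM mulrC ler_pM //.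
  apply: (le_trans (zt_sq _ kpos (ltnW k2))).
  by rewrite ler_wpM2l // sq_le // leq_pred.
by rewrite norm_wt1.
Qed.

(* averaging consecutive terms turns the alternating series into an absolutely
   convergent one *)
Lemma zt_cvg_alt k : posidx k -> (size k <= 2)%N ->
  exists L, Osq (fun n => zt n ((1%N, true) :: k) - L).
Proof.
move=> kpos k2; pose f n := wt (1%N, true) n * zt n.-1 k.
have f0 : f 0%N = 0 by rewrite /f /wt /= expr1 invr0 mulr0 mul0r.
have [|L HL] := @summable_Osq R (fun n => (f n + f n.-1) / 2) 128.
  case=> [|n] /=.
    have -> : (f 1%N + f 0%N) / 2 = - (zt 0 k / 2).
      by rewrite f0 /f /wt /ch /= !expr1 invr1; ring.
    have := zt_sq 0 kpos k2; have -> : sq 0 = 1 by rewrite /sq sqrtr1.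
    rewrite !mulr1 divr1 !ler_norml => /andP[H1 H2]; apply/andP; split; lra.
  rewrite natrSV_sq; set m := n.+1.
  have -> : f m.+1 + f m = ch true m.+1 *
      ((zt m k - zt m.-1 k) / m.+1%:R - zt m.-1 k * (m.+1%:R * m%:R)^-1).
    have -> : f m = - ch true m.+1 * zt m.-1 k / m%:R.
      have -> : ch true m.+1 = - ch true m by rewrite /ch exprS /= mulN1r.
      by rewrite /f /wt /= expr1; ring.
    have m0 : m%:R != 0 :> R by rewrite pnatr_eq0.
    have m1 : m%:R + 1 != 0 :> R by rewrite natr1 pnatr_eq0.
    by rewrite /f /wt /= expr1 -natr1; field; rewrite m0 m1.
  rewrite normrM [`|ch _ _ * _|]normrM norm_ch mul1r (ger0_norm (_ : 0 <= 2^-1)) //.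
  rewrite ler_pdivrMr //.
  apply: (le_trans (ler_normB _ _)); rewrite !normrM !normfV !normrM !normr_nat.
  have Hm : m%:R^-1 <= 2 / m.+1%:R :> R.
    rewrite -div1r ler_pdivrMr ?ltr0n // mulrAC ler_pdivlMr ?ltr0n // mul1r -natrM ler_nat.
    by rewrite /m; lia.
  have H1 := zt_step kpos k2 (ltn0Sn n : (0 < m)%N).
  have H2 : `|zt m.-1 k| <= 64 * sq m.
    by rewrite (le_trans (zt_sq _ kpos k2)) // ler_wpM2l // sq_le.
  have s0 := sq_gt0 R m.
  have i0 : 0 < m.+1%:R^-1 :> R by rewrite invr_gt0 ltr0n.
  have j0 : 0 < m%:R^-1 :> R by rewrite invr_gt0 ltr0n.
  have H3 : 64 * sq m / m%:R <= 64 * sq m * (2 / m.+1%:R) by rewrite ler_wpM2l // mulr_ge0 // ltW.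
  have H4 : `|zt m.-1 k| * (m.+1%:R^-1 / m%:R) <= 64 * sq m * (m.+1%:R^-1 * (2 / m.+1%:R)).
    by apply: ler_pM; rewrite ?mulr_ge0 ?(ltW i0) ?(ltW j0) ?(ler_pM2l i0).
  have H5 : `|zt m k - zt m.-1 k| / m.+1%:R <= 64 * sq m * (2 / m.+1%:R) / m.+1%:R.
    by rewrite ler_pM2r // (le_trans H1).
  rewrite invfM; apply: (le_trans (lerD H5 H4)).
  rewrite le_eqVlt; apply/orP; left; apply/eqP; rewrite -exprVn; ring.
exists L.
have fO : Osq (fun n => f n / 2).
  exists 64 => -[|n]; first by rewrite f0 mul0r normr0 divr_ge0 // ltW // sq_gt0.
  have := zt_sq n kpos k2; have := @norm_wt1 R (1%N, true) n.+1 isT isT => H1 H2.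
  have H3 := ler_pM (normr_ge0 _) (normr_ge0 _) H1 H2.
  have H4 : n.+1%:R^-1 * (64 * sq n) = 64 / sq n.
    have -> : n.+1%:R = sq n ^+ 2 by rewrite sq_sqr.
    have := sq_gt0 R n; move: (sq n) => a a0.
    by field; rewrite gt_eqF.
  have H5 : (sq n)^-1 <= 2 / sq n.+1.
    have [a0 b0] := (sq_gt0 R n, sq_gt0 R n.+1).
    rewrite ler_pdivlMr // mulrC ler_pdivrMr //.
    rewrite -(@ler_pXn2r _ 2) ?nnegrE ?mulr_ge0 ?ltW //.
    by rewrite exprMn !sq_sqr -!natr1; have := ler0n R n; lra.
  have H6 : `|f n.+1| <= 64 / sq n by rewrite -H4 /f normrM.
  rewrite normrM (ger0_norm (_ : 0 <= 2^-1)) //; lra.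
(* Since [f 0] = 0, the averaged sum differs from the original one by exactly [f n / 2], which is
   itself O(n^(-1/2)). *)
apply: (@eq_Osq _ (fun n => (sum1 n (fun n => (f n + f n.-1) / 2) - L) + f n / 2)).
  move=> n; rewrite addrAC; congr (_ - _); rewrite zt_cons -/(f).
  elim: n => [|n IH]; first by rewrite !sum1_0 f0 mul0r addr0.
  by rewrite !sum1S -IH /= -/(f n.+1); field.
exact: OsqD.
Qed.

Lemma zt_cvg s k : s != (1%N, false) -> posidx (s :: k) -> (size k <= 2)%N ->
  exists L, Osq (fun n => zt n (s :: k) - L).
Proof.
case: s => -[|[|m]] b // + /= kpos k2; last by move=> _; apply: zt_cvg_ge2.
by case: b => // _; exact: zt_cvg_alt.
Qed.

(** Prefixing 1 divides the error by n, which makes it summable; [C] is the total of these errors,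
    so only the model [e] remains to be summed. *)
Lemma zt_div k e : Osq (fun n => zt n k - e n) ->
  exists C, Osq (fun n => zt n ((1%N, false) :: k) - (sum1 n (fun i => i%:R^-1 * e i.-1) + C)).
Proof.
move=> [D HD].
have [|L HL] := @summable_Osq R (fun n => n%:R^-1 * (zt n.-1 k - e n.-1)) D.
  move=> n /=; rewrite normrM normfV normr_nat invfM mulrCA.
  by rewrite ler_wpM2l ?invr_ge0.
exists L; apply: eq_Osq HL => n; rewrite zt_cons opprD addrA -sum1B.
by congr (_ - _); apply: eq_sum1 => i _; rewrite wt1 mulrBr.
Qed.

(** The bound on the degree keeps P(H_n) within the reach of the estimates on H_n^2 and singles out
    the coefficient of T^2 as the only source of the shuffle correction. *)
Definition asymp f P := (size P <= 3)%N /\ Osq (fun n => f n - P.[harm n]).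

Lemma eq_asymp f g P : f =1 g -> asymp f P -> asymp g P.
Proof. by move=> fg [sP H]; split => //; apply: eq_Osq H => n; rewrite fg. Qed.

Lemma asymp_Osq f g P : Osq (fun n => f n - g n) -> asymp f P -> asymp g P.
Proof.
move=> fg [sP H]; split => //.
by apply: (@eq_Osq _ _ _ _ (OsqB H fg)) => n; ring.
Qed.

Lemma asympD f g P Q : asymp f P -> asymp g Q -> asymp (fun n => f n + g n) (P + Q).
Proof.
move=> [sP HP] [sQ HQ]; split.
  by rewrite (leq_trans (size_polyD _ _)) // geq_max sP.
by apply: (@eq_Osq _ _ _ _ (OsqD HP HQ)) => n; rewrite hornerD; ring.
Qed.

Lemma asympZ (c : R) f P : asymp f P -> asymp (fun n => c * f n) (c *: P).
Proof.
move=> [sP HP]; split; first by rewrite (leq_trans (size_scale_leq _ _)).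
by apply: (@eq_Osq _ _ _ _ (OsqZ c HP)) => n; rewrite hornerZ; ring.
Qed.

Lemma asympB f g P Q : asymp f P -> asymp g Q -> asymp (fun n => f n - g n) (P - Q).
Proof.
move=> HP HQ; have := asympD HP (asympZ (-1) HQ).
by rewrite scaleN1r; apply: eq_asymp => n; rewrite mulN1r.
Qed.

Lemma asympC f (L : R) : Osq (fun n => f n - L) -> asymp f L%:P.
Proof.
move=> H; split; first by rewrite (leq_trans (size_polyC_leq1 _)).
by apply: eq_Osq H => n; rewrite hornerC.
Qed.

Lemma asymp_harm : asymp harm 'X.
Proof.
split; first by rewrite size_polyX.
by apply: (@eq_Osq _ (fun=> 0)) (Osq0 R) => n; rewrite hornerX subrr.
Qed.

Lemma asymp_harm2 : asymp (fun n => harm n ^+ 2) 'X^2.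
Proof.
split; first by rewrite size_polyXn.
by apply: (@eq_Osq _ (fun=> 0)) (Osq0 R) => n; rewrite hornerXn subrr.
Qed.

Lemma asymp_sum1 (I : nat) (F : nat -> nat -> R) (G : nat -> {poly R}) :
  (forall i, (0 < i <= I)%N -> asymp (F i) (G i)) ->
  asymp (fun n => sum1 I (fun i => F i n)) (sum1 I G).
Proof.
elim: I => [|I IH] H.
  rewrite sum1_0; apply: (@eq_asymp (fun=> 0)); first by move=> n; rewrite sum1_0.
  by rewrite -polyC0; apply: asympC; apply: (@eq_Osq _ (fun=> 0)) (Osq0 R) => n; rewrite subrr.
rewrite sum1S; apply: (@eq_asymp (fun n => sum1 I (fun i => F i n) + F I.+1 n)).
  by move=> n; rewrite sum1S.
apply: asympD; last by apply: H; rewrite ltnS leqnn.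
by apply: IH => i /andP[i0 iI]; apply: H; rewrite i0 leqW.
Qed.

(** Dividing t Q(t) + c by t shows that Q(t) tends to 0 as well, so Q = 0 by induction and then c =
    0. All uniqueness statements rest on this. *)
Lemma poly_cvg0 (T : Type) (F : set_system T) {FF : ProperFilter F}
    (t : T -> R) Q : t x @[x --> F] --> +oo -> Q.[t x] @[x --> F] --> 0 -> Q = 0.
Proof.
move=> toy; elim/poly_ind: Q => [|Q c IH] // Qc0.
have t0 : \forall x \near F, 0 < t x by move/cvgryPgt : toy; apply.
have tV : (t x)^-1 @[x --> F] --> 0 by apply/gtr0_cvgV0.
have Q0 : Q.[t x] @[x --> F] --> 0.
  have -> : 0 = (0 - c) * 0 :> R by rewrite mulr0.
  have : ((Q * 'X + c%:P).[t x] - c) * (t x)^-1 @[x --> F] --> (0 - c) * 0.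
    by apply: cvgM => //; apply: cvgB => //; exact: cvg_cst.
  apply: cvg_trans; apply: near_eq_cvg; near=> x.
  have tx0 : 0 < t x by near: x.
  by rewrite hornerMXaddC addrK mulfK // gt_eqF.
have Q00 := IH Q0; move: Qc0; rewrite Q00 mul0r add0r.
under eq_fun do rewrite hornerC.
move=> /cvg_lim -/(_ (@norm_hausdorff _ _)).
by rewrite lim_cst // => ->; rewrite polyC0.
Unshelve. all: by end_near. Qed.

Lemma horner3 P (a : R) : (size P <= 3)%N -> P.[a] = P`_0 + P`_1 * a + P`_2 * a ^+ 2.
Proof.
by move=> sP; rewrite (horner_coef_wide _ sP) !big_ord_recr big_ord0 /= add0r expr0 mulr1 expr1.
Qed.

(** The increment log(n + 2) - log(n + 1) lies between 1/(n + 2) and 1/(n + 1), so [squeeze_limit]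
    applies with the telescoping bound 1/(n + 1). *)
Lemma harm_ln n : (0 < n)%N -> `|harm n - ln n%:R - euler_gamma R| <= n%:R^-1.
Proof.
pose b n := harm n.+1 - ln n.+1%:R.
have [||L HL] := @squeeze_limit R b (fun n => n.+1%:R^-1).
- by move=> m; rewrite invr_ge0.
- move=> m; rewrite /b harmS.
  have p1 : (m.+1%:R : R) \is Num.pos by rewrite posrE ltr0n.
  have p2 : (m.+2%:R : R) \is Num.pos by rewrite posrE ltr0n.
  have n1 : m.+1%:R != 0 :> R by rewrite pnatr_eq0.
  have n2 : m.+2%:R != 0 :> R by rewrite pnatr_eq0.
  have E2 : m.+2%:R = m.+1%:R + 1 :> R by rewrite natr1.
  have up : ln m.+2%:R - ln m.+1%:R <= m.+1%:R^-1 :> R.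
    rewrite -ln_div //; have -> : m.+2%:R / m.+1%:R = 1 + m.+1%:R^-1 :> R.
      by rewrite E2 mulrDl divff // mul1r.
    by rewrite le_ln1Dx // (lt_le_trans _ (_ : 0 <= _)) // ?invr_ge0 // oppr_lt0.
  have lo : m.+2%:R^-1 <= ln m.+2%:R - ln m.+1%:R :> R.
    rewrite -[X in _ <= X]opprK opprB -ln_div //.
    have -> : m.+1%:R / m.+2%:R = 1 + - m.+2%:R^-1 :> R.
      have -> : m.+1%:R = m.+2%:R - 1 :> R by rewrite E2 addrK.
      by rewrite mulrBl divff // mul1r.
    rewrite lerNr le_ln1Dx // ltrN2 invf_lt1 ?ltr0n // ltr1n //.
  move: up lo; move: (ln (m.+2%:R : R)) (ln (m.+1%:R : R)) (m.+1%:R^-1 : R).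
  move: (m.+2%:R^-1 : R) (harm m.+1) => i2 h l2 l1 i1 up lo.
  by rewrite ler_norml; apply/andP; split; lra.
have bL : b @ \oo --> L.
  have H : Osq (fun n => b n - L).
    exists 1 => m; apply: (le_trans (HL m)); rewrite mul1r lef_pV2 ?posrE ?sq_gt0 ?ltr0n //.
    by rewrite -sq_sqr expr2 ler_peMr ?sq_ge1 // ltW // sq_gt0.
  by apply/subr_cvg0; exact: (Osq_cvg H).
have -> : euler_gamma R = L.
  apply/cvg_lim => //; rewrite -(@cvg_shiftS _ (_ : nat -> R)) /=.
  apply: cvg_trans bL; apply: near_eq_cvg; near=> m.
  by rewrite /b harmE.
by case: n => // n _; exact: HL.
Unshelve. all: by end_near. Qed.

(** Replacing H_n by log n + γ = H_n - d_n with d_n = O(1/n) changes a quadratic by terms in d_n,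
    H_n d_n and d_n^2, all of which vanish. *)
Lemma asymp_stuffle k P : asymp (zt^~ k) P -> stuffle_reg k P.
Proof.
move=> [sP HP]; rewrite /stuffle_reg.
pose d n := harm n - (ln n%:R + euler_gamma R).
have inv2 n : (0 < n)%N -> n%:R^-1 <= 2 / n.+1%:R :> R.
  move=> n0; rewrite -div1r ler_pdivrMr ?ltr0n // mulrAC ler_pdivlMr ?ltr0n // mul1r -natrM ler_nat; lia.
have dn n : (0 < n)%N -> `|d n| <= n%:R^-1 by move=> n0; rewrite /d opprD addrA harm_ln.
have dO : Osq d.
  (* At n = 0 the value of [d] depends on the conventional [ln 0]; the constant is enlarged to cover
     it. *)
  exists (2 + `|d 0%N|) => -[|n].
    by rewrite /sq sqrtr1 divr1 lerDr.
  apply: (le_trans (dn _ _)) => //; apply: (le_trans (inv2 _ _)) => //.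
  apply: (@le_trans _ _ (2 / sq n.+1)).
    rewrite ler_wpM2l // lef_pV2 ?posrE ?sq_gt0 ?ltr0n //.
    by rewrite -sq_sqr expr2 ler_peMr ?sq_ge1 // ltW // sq_gt0.
  by rewrite ler_pM2r ?invr_gt0 ?sq_gt0 // lerDl.
have hdO : Osq (fun n => harm n * d n).
  apply: (@Osq_le _ _ (fun n => 2 * (harm n / n.+1%:R))); last first.
    by apply: OsqZ; exact: Osq_harm.
  case=> [|n]; first by rewrite harm0 mul0r normr0.
  rewrite mulrCA normrM [X in _ <= X]normrM ler_wpM2l //.
  apply: (le_trans (dn _ _)) => //; apply: (le_trans (inv2 _ _)) => //.
  exact: ler_norm.
have [D dD] := Osq_bounded dO.
have H : Osq (fun n => P`_1 * d n + (2 * P`_2) * (harm n * d n) - P`_2 * (d n * d n)).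
  apply: OsqB; first by apply: OsqD; apply: OsqZ.
  by apply: OsqZ; exact: (@OsqMb _ _ _ D).
apply: (@Osq_cvg _ (fun M => zt M k - P.[ln (M%:R : R) + euler_gamma R])).
apply: (@eq_Osq _ _ _ _ (OsqD HP H)) => n.
rewrite !horner3 //; have -> : ln n%:R + euler_gamma R = harm n - d n by rewrite /d; ring.
by ring.
Qed.

Lemma cvg_ln_gamma : (fun M : nat => ln (M%:R : R) + euler_gamma R) @ \oo --> +oo.
Proof.
apply/cvgryPge => A; near=> n.
rewrite -lerBlDr -[X in X <= _]expRK ler_ln ?posrE ?expR_gt0 //.
  near: n; exact: nbhs_infty_ger.
rewrite (lt_le_trans (expR_gt0 (A - euler_gamma R))) //; near: n; exact: nbhs_infty_ger.
Unshelve. all: by end_near. Qed.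

Lemma stuffle_reg_unique k P Q : stuffle_reg k P -> stuffle_reg k Q -> P = Q.
Proof.
move=> HP HQ; apply/eqP; rewrite -subr_eq0; apply/eqP.
apply: (@poly_cvg0 _ \oo _ (fun M : nat => ln (M%:R : R) + euler_gamma R)).
  exact: cvg_ln_gamma.
pose t (M : nat) : R := ln M%:R + euler_gamma R.
rewrite (_ : (fun x => _) =
    (fun n => (zt n k - Q.[t n]) - (zt n k - P.[t n]))); last first.
  by apply/funext => n; rewrite hornerD hornerN /t; ring.
by rewrite -[0](subrr 0); apply: cvgB.
Qed.

Lemma asymp_zeta_st k P : asymp (zt^~ k) P -> zeta_st R k = P.
Proof.
move=> /asymp_stuffle HP; apply: xget_unique => // Q HQ.
exact: stuffle_reg_unique HQ HP.
Qed.

Lemma asymp_unique f P Q : asymp f P -> asymp f Q -> P = Q.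
Proof.
move=> [sP HP] [sQ HQ]; apply/eqP; rewrite -subr_eq0; apply/eqP.
have toy : harm @ \oo --> +oo.
  have := cvg_ln_gamma => /cvgryPge H; apply/cvgryPge => A; near=> n.
  have n0 : (0 < n)%N by near: n; exact: nbhs_infty_gt.
  have := harm_ln n0; rewrite ler_norml => /andP[H1 _].
  have : n%:R^-1 <= 1 :> R by rewrite invf_le1 ?ler1n ?ltr0n.
  have : A + 1 <= ln n%:R + euler_gamma R by near: n; exact: H.
  lra.
apply: (@poly_cvg0 _ \oo _ harm) => //.
rewrite (_ : (fun x => _) =
    (fun n => (f n - Q.[harm n]) - (f n - P.[harm n]))); last first.
  by apply/funext => n; rewrite hornerD hornerN; ring.
exact: Osq_cvg (OsqB HQ HP).
Unshelve. all: by end_near. Qed.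

Lemma Osq_zeta k (L : R) : Osq (fun n => zt n k - L) -> zeta R k = L.
Proof.
move=> H; apply/cvg_lim => //; apply/subr_cvg0; exact: (Osq_cvg H).
Qed.

End Expansions.

(** * Iterated integrals as power series *)

Section PowerSeries.
Local Open Scope classical_set_scope.
Local Open Scope ring_scope.
Variable R : realType.
Implicit Types (c d : nat -> R) (x t p q a : R) (n : nat) (ws : seq R).

Definition pser c x : R := limn (pseries c x).

(** Termwise differentiation asks for convergence of the twice differentiated series; coefficients
    of linear growth then become cubic. *)
Definition cubic_growth c :=
  exists B : R, forall n, `|c n| <= B * (n.+1%:R * n.+2%:R * n.+3%:R).

(** The larger quantity (1 + n(1 - r)) r^n starts at 1 and does not increase with n. *)
Lemma natX_bound (r : R) n : 0 <= r <= 1 -> n%:R * (1 - r) * r ^+ n <= 1.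
Proof.
move=> /andP[r0 r1]; apply: (@le_trans _ _ ((1 + n%:R * (1 - r)) * r ^+ n)).
  by rewrite ler_wpM2r ?exprn_ge0 //; lra.
elim: n => [|n IH]; first by rewrite expr0; lra.
apply: le_trans IH; rewrite exprS mulrA ler_wpM2r ?exprn_ge0 // -natr1.
have n0 : 0 <= n%:R :> R by [].
rewrite -subr_ge0 (_ : _ - _ = (n%:R + 1) * (1 - r) ^+ 2); last by ring.
by rewrite mulr_ge0 ?sqr_ge0 // addr_ge0.
Qed.

Lemma cvg_pseries c x : cubic_growth c -> `|x| < 1 -> cvgn (pseries c x).
Proof.
move=> [B HB] x1; apply: normed_cvg.
(* The tangent inequality r^4 >= 4r - 3 = |x| splits |x|^n into four powers r^n: three absorb the
   linear factors, and the fourth leaves a geometric series. *)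
pose r := (3 + `|x|) / 4; have x0 := normr_ge0 x.
have r0 : 0 < r by rewrite /r; lra.
have r1 : r < 1 by rewrite /r; lra.
have rx : `|x| <= r ^+ 4.
  have -> : `|x| = 4 * r - 3 by rewrite /r; lra.
  rewrite -subr_ge0 (_ : _ - _ = (r - 1) ^+ 2 * (r ^+ 2 + 2 * r + 3)); last by ring.
  by rewrite mulr_ge0 ?sqr_ge0 //; nra.
pose D := (1 - r)^-1 / r ^+ 3.
have d0 : 0 < 1 - r by lra.
have D0 : 0 < D by rewrite divr_gt0 ?invr_gt0 ?exprn_gt0.
have bd n i : (i <= 3)%N -> (n + i)%:R * r ^+ n <= D.
  move=> i3; have H := @natX_bound r (n + i) (introT andP (conj (ltW r0) (ltW r1))).
  rewrite /D ler_pdivlMr ?exprn_gt0 // -div1r ler_pdivlMr //.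
  apply: le_trans H; rewrite exprD.
  have : r ^+ 3 <= r ^+ i by rewrite ler_wiXn2l // ltW.
  have : 0 <= (n + i)%:R * (1 - r) * r ^+ n by rewrite !mulr_ge0 ?exprn_ge0 // ltW.
  move: (r ^+ 3) (r ^+ i) ((n + i)%:R : R) (r ^+ n) => X Y Z W; nra.
have B0 : 0 <= B.
  by have := le_trans (normr_ge0 _) (HB 0%N); rewrite pmulr_lge0 // !mulr_gt0.
apply: (@series_le_cvg _ _ (geometric (B * D ^+ 3) r)).
- by move=> n; exact: normr_ge0.
- move=> n; apply: geometric_ge0; last exact: ltW.
  by rewrite mulr_ge0 // exprn_ge0 // ltW.
- move=> n /=; rewrite normrM normrX.
  apply: (@le_trans _ _ (B * (n.+1%:R * n.+2%:R * n.+3%:R) * (r ^+ 4) ^+ n)).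
    by apply: ler_pM; rewrite ?exprn_ge0 // lerXn2r ?nnegrE ?exprn_ge0 // ltW.
  have -> : B * (n.+1%:R * n.+2%:R * n.+3%:R) * r ^+ 4 ^+ n =
    B * (((n + 1)%:R * r ^+ n) * ((n + 2)%:R * r ^+ n) * ((n + 3)%:R * r ^+ n)) * r ^+ n.
    by rewrite addn1 addn2 addn3 -exprM (_ : 4 * n = n + n + n + n)%N; [rewrite !exprD; ring | lia].
  rewrite ler_wpM2r ?exprn_ge0 ?(ltW r0) // ler_wpM2l //.
  have rn0 i : 0 <= (n + i)%:R * r ^+ n by rewrite mulr_ge0 // exprn_ge0 // ltW.
  have -> : D ^+ 3 = D * D * D by ring.
  apply: ler_pM; [exact: mulr_ge0 | exact: rn0 | | exact: bd].
  by apply: ler_pM; [exact: rn0 | exact: rn0 | exact: bd | exact: bd].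
- by apply: is_cvg_geometric_series; rewrite ger0_norm // ltW.
Qed.

Lemma pser_cvg c x : cubic_growth c -> `|x| < 1 ->
  \sum_(0 <= i < n) c i * x ^+ i @[n --> \oo] --> pser c x.
Proof. by move=> cg x1; have := cvg_pseries cg x1. Qed.

Lemma pser_unique c x l : \sum_(0 <= i < n) c i * x ^+ i @[n --> \oo] --> l ->
  pser c x = l.
Proof. by move=> H; apply/cvg_lim. Qed.

Lemma cubic_1 (B : R) c : (forall n, `|c n| <= B) -> cubic_growth c.
Proof.
move=> HB; exists B => n; apply: (le_trans (HB n)).
have B0 := le_trans (normr_ge0 _) (HB 0%N).
by rewrite ler_peMr // -!natrM ler1n.
Qed.

Lemma cubic_lin (B : R) c : (forall n, `|c n| <= B * n.+1%:R) -> cubic_growth c.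
Proof.
move=> HB; exists B => n; apply: (le_trans (HB n)).
have B0 : 0 <= B by have := le_trans (normr_ge0 _) (HB 0%N); rewrite mulr1.
by rewrite ler_wpM2l // -mulrA ler_peMr // -natrM ler1n.
Qed.

Lemma cubic_quad (B : R) c : (forall n, `|c n| <= B * (n.+1%:R * n.+2%:R)) -> cubic_growth c.
Proof.
move=> HB; exists B => n; apply: (le_trans (HB n)).
have B0 : 0 <= B by have := le_trans (normr_ge0 _) (HB 0%N); rewrite pmulr_lge0.
by rewrite ler_wpM2l // ler_peMr // ?mulr_ge0 // ler1n.
Qed.

Lemma diffs_bound (B : R) c (h : nat -> R) :
  (forall n, `|c n| <= B * h n) ->
  forall n, `|pseries_diffs c n| <= B * (n.+1%:R * h n.+1).
Proof.
move=> HB n; rewrite /pseries_diffs normrM normr_nat mulrCA.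
by rewrite ler_wpM2l.
Qed.

Lemma pser_derive (B : R) c t : (forall n, `|c n| <= B * n.+1%:R) -> `|t| < 1 ->
  is_derive t 1 (pser c) (pser (pseries_diffs c) t).
Proof.
move=> HB t1; have B0 : 0 <= B by have := le_trans (normr_ge0 _) (HB 0%N); rewrite mulr1.
have [K /andP[tK K1]] : exists K : R, `|t| < K < 1.
  by exists ((1 + `|t|) / 2); have t0 := normr_ge0 t; apply/andP; split; lra.
have K0 : 0 <= K by rewrite ltW // (le_lt_trans (normr_ge0 t)).
have H1 := diffs_bound HB; have H2 := diffs_bound H1.
apply: (@pseries_snd_diffs _ c K); rewrite ?(ger0_norm K0) //;
  apply: cvg_pseries; rewrite ?(ger0_norm K0) //.
- exact: cubic_lin HB.
- exact: cubic_quad H1.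
- exists B => n; apply: (le_trans (H2 n)); rewrite ler_wpM2l //.
  by rewrite mulrA.
Qed.

(** Applied to the factors t, a - t and 1 - t, this replaces a division of power series by a
    two-term recursion of coefficients. *)
Lemma pser_affine c d p q x : cubic_growth c -> cubic_growth d -> `|x| < 1 ->
  p * d 0%N = c 0%N -> (forall n, p * d n.+1 + q * d n = c n.+1) ->
  (p + q * x) * pser d x = pser c x.
Proof.
move=> cg dg x1 c0 cS; apply/esym/pser_unique.
rewrite -(@cvg_shiftS _ (_ : nat -> R)) /=.
have -> : (fun n => \sum_(0 <= i < n.+1) c i * x ^+ i) =
  (fun n => p * (\sum_(0 <= i < n.+1) d i * x ^+ i) +
            q * x * (\sum_(0 <= i < n) d i * x ^+ i)).
  apply/funext => n; rewrite !big_nat_recl //= !expr0 !mulr1 -c0 mulrDr -addrA.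
  congr (_ + _); rewrite !mulr_sumr -big_split /=; apply: eq_bigr => i _.
  by rewrite -cS exprS; ring.
rewrite mulrDl; apply: cvgD; apply: cvgM; try exact: cvg_cst.
  by rewrite (@cvg_shiftS _ (fun n => \sum_(0 <= i < n) d i * x ^+ i)); exact: pser_cvg.
exact: pser_cvg.
Qed.

Lemma pser0 c : pser c 0 = c 0%N.
Proof.
apply: pser_unique; rewrite -(@cvg_shiftS _ (_ : nat -> R)) /=.
have -> : (fun n => \sum_(0 <= i < n.+1) c i * 0 ^+ i) = fun=> c 0%N.
  apply/funext => n; rewrite big_nat_recl //= expr0 mulr1 big1 ?addr0 // => i _.
  by rewrite exprS mul0r mulr0.
exact: cvg_cst.
Qed.

Notation mu := (@lebesgue_measure R).

Lemma FTC_unit (F g f : R -> R) x :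
  (forall t, `|t| < 1 -> is_derive t 1 F (g t)) ->
  (forall t, `|t| < 1 -> derivable g t 1) ->
  0 <= x < 1 -> (forall t, 0 < t <= x -> f t = g t) ->
  Rintegral mu `[0, x] f = F x - F 0.
Proof.
move=> dF dg /andP[x0 x1] fg; move: x0; rewrite le_eqVlt => /predU1P[<-|x0].
  by rewrite set_itv1 Rintegral_set1 subrr.
have dom t : t \in `[0, x] -> `|t| < 1.
  by rewrite in_itv /= => /andP[t0 tx]; rewrite ger0_norm // (le_lt_trans tx).
have gc : {within `[0, x], continuous g}.
  apply: continuous_in_subspaceT => t /set_mem /= /dom t1.
  by apply: differentiable_continuous; apply/derivable1_diffP; exact: dg.
have gi : mu.-integrable `[0, x] (EFin \o g).
  by apply: continuous_compact_integrable => //; exact: segment_compact.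
have gi' : mu.-integrable `]0, x] (EFin \o g).
  by apply: integrableS gi => //; apply: subset_itvr; rewrite bnd_simp.
have fgi : {in `]0, x]%classic, f =1 g}.
  by move=> t /set_mem /=; rewrite in_itv /= => /fg.
have fi : mu.-integrable `]0, x] (EFin \o f).
  apply: eq_integrable gi' => // t Ht /=; by rewrite fgi.
rewrite -Rintegral_itv_obnd_cbnd // (@eq_Rintegral _ _ _ mu _ g) // Rintegral_itv_obnd_cbnd //.
have cF t : `|t| < 1 -> {for t, continuous F}.
  move=> t1; apply: differentiable_continuous; apply/derivable1_diffP.
  by have [] := dF t t1.
rewrite /Rintegral (@continuous_FTC2 _ _ F) //.
- split.
  + move=> t; rewrite in_itv /= => /andP[t0 tx].
    by have [] := dF t (dom t _) => //; rewrite in_itv /= !ltW.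
  + by apply: cvg_at_right_filter; apply: cF; rewrite normr0.
  + by apply: cvg_at_left_filter; apply: cF; rewrite ger0_norm // ltW.
- move=> t; rewrite in_itv /= => /andP[t0 tx]; rewrite derive1E.
  have t1 : `|t| < 1 by apply: dom; rewrite in_itv /= !ltW.
  by have [_ ->] := dF t t1.
Qed.

(** Taylor coefficients of the iterated integral. Since a^2 = 1, 1/(a - t) is the sum of a^(j+1)
    t^j; the division by n is integration, and n^-1 = 0 at n = 0 gives the vanishing constant
    term. *)
Fixpoint coef ws n : R :=
  match ws with
  | [::] => (n == 0%N)%:R
  | a :: ws' => (if a == 0 then coef ws' n
                 else \sum_(0 <= m < n) a ^+ (n - m) * coef ws' m) / n%:R
  end.

(** A final letter dt/t is forbidden, as its integral diverges at 0; the other letters must be 1 or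
    -1. *)
Fixpoint wfword ws : bool :=
  match ws with
  | [::] => true
  | a :: ws' => (if a == 0 then ws' != [::] else a ^+ 2 == 1) && wfword ws'
  end.

Lemma coef_cons0 a ws : coef (a :: ws) 0 = 0.
Proof. by rewrite /= invr0 mulr0. Qed.

Lemma norm_sqr1 a : a ^+ 2 = 1 -> `|a| = 1.
Proof.
by move/eqP; rewrite sqrf_eq1 => /orP[] /eqP ->; rewrite ?normrN normr1.
Qed.

Lemma coef_le1 ws n : wfword ws -> `|coef ws n| <= 1.
Proof.
elim: ws n => [|a ws IH] n /=; first by case: eqP; rewrite ?normr1 ?normr0.
case: n => [|n]; first by rewrite invr0 mulr0 normr0.
have n1 : 0 < n.+1%:R :> R by rewrite ltr0n.
rewrite normrM normfV normr_nat ler_pdivrMr // mul1r.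
case: eqP => [_|_] /andP[Ha wf].
  by rewrite (le_trans (IH _ wf)) // ler1n.
apply: (le_trans (ler_norm_sum _ _ _)).
apply: (@le_trans _ _ (\sum_(0 <= m < n.+1) 1)); last by rewrite sumr_const_nat subn0.
apply: ler_sum => m _; rewrite normrM normrX (norm_sqr1 (eqP Ha)) expr1n mul1r.
exact: IH.
Qed.

Lemma iterint_pser ws x : wfword ws -> 0 <= x < 1 -> iterint x ws = pser (coef ws) x.
Proof.
elim: ws x => [|a ws IH] x.
  move=> _ /andP[x0 x1]; apply/esym/pser_unique; rewrite -(@cvg_shiftS _ (_ : nat -> R)) /=.
  have -> : (fun n => \sum_(0 <= i < n.+1) (i == 0%N)%:R * x ^+ i) = fun=> 1.
    apply/funext => n; rewrite big_nat_recl //= mul1r expr0 big1 ?addr0 // => i _.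
    by rewrite mul0r.
  exact: cvg_cst.
move=> wf x01; have wf' : wfword ws by move: wf => /= /andP[].
pose c := coef (a :: ws); pose d := pseries_diffs c.
have c1 n : `|c n| <= 1 * n.+1%:R.
  by rewrite mul1r (le_trans (coef_le1 n wf)) // ler1n.
have dE n : d n = if a == 0 then coef ws n.+1
                  else \sum_(0 <= m < n.+1) a ^+ (n.+1 - m) * coef ws m.
  by rewrite /d /pseries_diffs /c /= mulrCA divff ?pnatr_eq0 // mulr1.
have d1 n : `|d n| <= 1 * n.+1%:R.
  by rewrite /d /pseries_diffs normrM normr_nat mul1r ler_piMr // coef_le1.
rewrite [LHS]/=; transitivity (pser c x - pser c 0); last first.
  by rewrite pser0 /c coef_cons0 subr0.
apply: (@FTC_unit (pser c) (pser d)) => //.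
- by move=> t; apply: pser_derive c1.
- by move=> t t1; have [] := pser_derive d1 t1.
move=> t /andP[t0 tx].
have t1 : `|t| < 1 by rewrite ger0_norm ?ltW // (le_lt_trans tx) //; case/andP: x01.
rewrite IH //; last by rewrite ltW //= (le_lt_trans tx) //; case/andP: x01.
have cg : cubic_growth (coef ws) by apply: (@cubic_1 1) => n; exact: coef_le1.
have dg := cubic_lin d1.
move: wf => /=; rewrite /omega; case: eqP => [a0|a0] /andP[Ha _].
  rewrite -(@pser_affine (coef ws) d 0 1 t) //.
  - by rewrite add0r mul1r mulrA mulVf ?mul1r // gt_eqF.
  - by rewrite mul0r; case: (ws) Ha => // b ws' _; rewrite coef_cons0.
  - by move=> n; rewrite mul0r add0r mul1r dE a0 eqxx.
have aa : a * a = 1 by rewrite -expr2 (eqP Ha).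
rewrite -(@pser_affine (coef ws) d a (-1) t) //.
- rewrite mulN1r mulrA mulVf ?mul1r // subr_eq0.
  apply/eqP => at_; move: aa t1; rewrite at_ => tt t1.
  by have := norm_sqr1 (_ : t ^+ 2 = 1); rewrite expr2 tt => /(_ erefl); lra.
- by rewrite dE ifF; [rewrite big_nat1 subn0 expr1 mulrA aa mul1r | apply/eqP].
- move=> n; rewrite !dE (negbTE (introN eqP a0)).
  rewrite big_nat_recr //= subSnn expr1 mulrDr mulrA aa mul1r mulN1r.
  rewrite addrAC -[RHS]add0r; congr (_ + _); apply/eqP; rewrite subr_eq0; apply/eqP.
  rewrite mulr_sumr; apply: eq_big_nat => m /andP[_ mn].
  by rewrite (subSn (ltnW mn)) exprS mulrA mulrA aa mul1r.
Qed.

End PowerSeries.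

(** * Abel means and the shuffle regularization *)

Section AbelMeans.
Local Open Scope classical_set_scope.
Local Open Scope ring_scope.
Variable R : realType.
Implicit Types (c d e f : nat -> R) (x t : R) (n : nat) (k : eindex) (P Q : {poly R}).

Local Notation zt := (@zeta_trunc R).
Local Notation harm := (@harm R).

(** The part of the Euler sum with outermost variable equal to n, that is, a coefficient of the
    multiple polylogarithm. *)
Definition ztdiff k n : R := if n is m.+1 then zt m.+1 k - zt m k else zt 0 k.

Lemma sum_ztdiff k n : \sum_(0 <= m < n.+1) ztdiff k m = zt n k.
Proof.
elim: n => [|n IH]; first by rewrite big_nat1.
by rewrite big_nat_recr //= IH addrC subrK.
Qed.

Lemma coef_nseq0 (ws : seq R) j n : coef (nseq j 0 ++ ws) n = coef ws n / n%:R ^+ j.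
Proof.
elim: j => [|j IH]; first by rewrite expr0 divr1.
by rewrite [nseq _ _ ++ _]/= [LHS]/= eqxx IH exprSr invfM mulrA.
Qed.

(** The geometric factor a^(n-m) meets the inner factor a^m and gives a^n = acc^n z^n, where z^n is
    the sign of the outermost variable. This is why the letters are the products a_k. *)
Lemma coef_word (acc : R) k n : acc ^+ 2 = 1 -> posidx k ->
  coef (word_aux acc k) n = acc ^+ n * ztdiff k n.
Proof.
elim: k acc n => [|[s z] k IH] acc n acc1.
  move=> _ /=; case: n => [|n]; first by rewrite expr0 mul1r /= zt_nil.
  by rewrite /= !zt_nil subrr mulr0.
move=> /= /andP[/= s0 kpos]; set a := acc * sgn R z.
have a1 : a ^+ 2 = 1 by rewrite /a exprMn acc1 mul1r; case: (z); rewrite /= ?sqrrN expr1n.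
have a0 : a != 0 by apply: contra_eq_neq a1 => ->; rewrite expr0n /= eq_sym oner_neq0.
rewrite coef_nseq0 /= (negbTE a0).
case: n => [|n]; first by rewrite invr0 mulr0 mul0r /= zt_0 mulr0.
rewrite (@eq_big_nat _ _ _ _ _ _ (fun m => a ^+ n.+1 * ztdiff k m)); last first.
  by move=> m /andP[_ mn]; rewrite IH // mulrA -exprD subnK // ltnW.
rewrite -mulr_sumr sum_ztdiff /= ztS addrAC subrr add0r /wt /= /ch /a exprMn.
have -> : n.+1%:R ^+ s = n.+1%:R * n.+1%:R ^+ s.-1 :> R by rewrite -exprS prednK.
by rewrite invfM; ring.
Qed.

Lemma wfword_word (acc : R) k : acc ^+ 2 = 1 -> wfword (word_aux acc k).
Proof.
elim: k acc => [|[s z] k IH] acc acc1 //=.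
have a1 : (acc * sgn R z) ^+ 2 = 1.
  by rewrite exprMn acc1 mul1r; case: (z); rewrite /= ?sqrrN expr1n.
elim: s.-1 => [|j IHj] /=.
  rewrite a1 eqxx IH // andbT; case: eqP => // a0; move: a1.
  by rewrite a0 expr0n /= => /eqP; rewrite eq_sym oner_eq0.
by rewrite eqxx IHj andbT; case: (j).
Qed.

Lemma ztdiff_le1 k n : posidx k -> `|ztdiff k n| <= 1.
Proof.
move=> kpos; have := @coef_word 1 k n (expr1n _ _) kpos.
by rewrite expr1n mul1r => <-; apply: coef_le1; apply: wfword_word; rewrite expr1n.
Qed.

Lemma zt_lin k n : posidx k -> `|zt n k| <= 1 * n.+1%:R.
Proof.
move=> kpos; rewrite -sum_ztdiff mul1r; apply: (le_trans (ler_norm_sum _ _ _)).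
apply: (@le_trans _ _ (\sum_(0 <= m < n.+1) 1)); last by rewrite sumr_const_nat subn0.
by apply: ler_sum => m _; exact: ztdiff_le1.
Qed.

Lemma iterint_word k x : posidx k -> 0 <= x < 1 ->
  iterint x (word R k) = (1 - x) * pser (zt^~ k) x.
Proof.
move=> kpos /andP[x0 x1].
rewrite iterint_pser ?x0 ?x1 //; last by apply: wfword_word; rewrite expr1n.
have -> : coef (word R k) = ztdiff k.
  by apply/funext => n; rewrite /word coef_word ?expr1n ?mul1r.
rewrite -(@pser_affine _ (ztdiff k) (zt^~ k) 1 (-1) x).
- by rewrite mulN1r.
- by apply: (@cubic_1 _ 1) => n; exact: ztdiff_le1.
- by apply: (@cubic_lin _ 1) => n; exact: zt_lin.
- by rewrite ger0_norm.
- by rewrite mul1r.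
- by move=> n; rewrite mul1r mulN1r.
Qed.

Lemma pserD c d x : cubic_growth c -> cubic_growth d -> `|x| < 1 ->
  pser (fun n => c n + d n) x = pser c x + pser d x.
Proof.
move=> cg dg x1; apply: pser_unique.
have -> : (fun n => \sum_(0 <= i < n) (c i + d i) * x ^+ i) =
  (fun n => \sum_(0 <= i < n) c i * x ^+ i + \sum_(0 <= i < n) d i * x ^+ i).
  by apply/funext => n; rewrite -big_split; apply: eq_bigr => i _; rewrite mulrDl.
by apply: cvgD; exact: pser_cvg.
Qed.

Lemma pserZ (b : R) c x : cubic_growth c -> `|x| < 1 ->
  pser (fun n => b * c n) x = b * pser c x.
Proof.
move=> cg x1; apply: pser_unique.
have -> : (fun n => \sum_(0 <= i < n) (b * c i) * x ^+ i) =
  (fun n => b * \sum_(0 <= i < n) c i * x ^+ i).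
  by apply/funext => n; rewrite mulr_sumr; apply: eq_bigr => i _; rewrite mulrA.
by apply: cvgM; [exact: cvg_cst | exact: pser_cvg].
Qed.

Lemma cubicD c d : cubic_growth c -> cubic_growth d -> cubic_growth (fun n => c n + d n).
Proof.
move=> [B HB] [D HD]; exists (B + D) => n.
by rewrite mulrDl (le_trans (ler_normD _ _)) // lerD.
Qed.

Lemma cubicZ (b : R) c : cubic_growth c -> cubic_growth (fun n => b * c n).
Proof.
move=> [B HB]; exists (`|b| * B) => n; rewrite normrM.
apply: (le_trans (ler_wpM2l (normr_ge0 b) (HB n))).
by rewrite le_eqVlt; apply/orP; left; apply/eqP; ring.
Qed.

Lemma sum_ltn_le (N n : nat) : (\sum_(0 <= i < n) (i < N) <= N)%N.
Proof.
suff -> : (\sum_(0 <= i < n) (i < N) = minn n N)%N by rewrite geq_minr.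
by elim: n => [|n IH]; [rewrite big_geq ?min0n | rewrite big_nat_recr //= IH; lia].
Qed.

(** Regularity of Abel means: the terms below [N] contribute at most eps N D, and the tail at most
    r/2, because eps times the geometric sum is at most 1. *)
Lemma pser_Osq_cvg e : Osq e -> eps * pser e (1 - eps) @[eps --> 0^'+] --> 0.
Proof.
move=> eO; have [D eD] := Osq_bounded eO.
have D0 : 0 <= D := le_trans (normr_ge0 _) (eD 0%N).
have /cvgr0Pnorm_le e0 := Osq_cvg eO.
apply/cvgr0Pnorm_lt => r r0.
have r20 : 0 < r / 2 by rewrite divr_gt0.
have [N _ HN] := e0 _ r20.
have ND : 0 < N%:R * D + 1 by rewrite ltr_wpDl // mulr_ge0.
have rND : 0 < r / 2 / (N%:R * D + 1) by rewrite divr_gt0.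
near=> eps.
have eps0 : 0 < eps by near: eps; exact: nbhs_right_gt.
have eps1 : eps < 1 by near: eps; exact: nbhs_right_lt.
have epsN : eps * (N%:R * D) < r / 2.
  have : eps < r / 2 / (N%:R * D + 1).
    by near: eps; exact: nbhs_right_lt.
  rewrite ltr_pdivlMr //; apply: lt_trans.
  by rewrite ltr_pM2l // ltrDl.
have x1 : `|1 - eps| < 1 by rewrite ger0_norm; lra.
pose x := 1 - eps; have x0 : 0 <= x by rewrite /x; lra.
have eg : cubic_growth e by exact: cubic_1 eD.
have bound n : `|\sum_(0 <= i < n) e i * x ^+ i| <= N%:R * D + r / 2 / eps.
  apply: (@le_trans _ _ (\sum_(0 <= i < n) ((i < N)%N%:R * D + r / 2 * x ^+ i))).
    apply: (le_trans (ler_norm_sum _ _ _)); apply: ler_sum => i _.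
    rewrite normrM (ger0_norm (exprn_ge0 _ x0)).
    have xi0 : 0 <= x ^+ i by exact: exprn_ge0.
    have xi1 : x ^+ i <= 1 by rewrite exprn_ile1 // /x; lra.
    case: ltnP => iN; last first.
      by rewrite mul0r add0r ler_wpM2r // HN.
    have H1 : `|e i| * x ^+ i <= D * 1 by rewrite ler_pM.
    have H2 : 0 <= r / 2 * x ^+ i by rewrite mulr_ge0 // ltW.
    by rewrite mul1r; lra.
  rewrite big_split /=; apply: lerD.
    rewrite -mulr_suml ler_wpM2r // -natr_sum ler_nat.
    exact: sum_ltn_le.
  rewrite -mulr_sumr ler_wpM2l ?(ltW r20) //.
  have -> : eps = 1 - x by rewrite /x; ring.
  have := @geometric_seriesE R 1 x; rewrite (lt_eqF (_ : x < 1)); last by rewrite /x; lra.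
  move=> /(_ isT) /(congr1 (fun f => f n)) /=.
  rewrite /series /= => E; under eq_bigr do rewrite -[x ^+ _]mul1r.
  rewrite E mul1r -[X in _ <= X]mul1r ler_pM2r ?invr_gt0 ?subr_gt0; last by rewrite /x; lra.
  by rewrite gerBl exprn_ge0.
have : `|pser e x| <= N%:R * D + r / 2 / eps.
  have H : `|\sum_(0 <= i < n) e i * x ^+ i| @[n --> \oo] --> `|pser e x|.
    exact: cvg_norm (pser_cvg eg x1).
  by apply: (cvgr_to_le H); exact: nearW.
rewrite normrM (gtr0_norm eps0) => H.
apply: (@le_lt_trans _ _ (eps * (N%:R * D + r / 2 / eps))); first by rewrite ler_pM2l.
have E : eps * (r / 2 / eps) = r / 2 by field; rewrite gt_eqF.
by rewrite mulrDr E; lra.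
Unshelve. all: by end_near. Qed.

Lemma derive_ln1B t : `|t| < 1 -> is_derive t 1 (fun t => - ln (1 - t)) (1 - t)^-1.
Proof.
move=> t1; have t0 : 0 < 1 - t by rewrite subr_gt0 (le_lt_trans (ler_norm t)).
have := is_derive1_ln t0 => H.
apply: is_derive_eq.
by ring.
Qed.

Lemma iterint_1 x : 0 <= x < 1 -> iterint x [:: 1] = - ln (1 - x).
Proof.
move=> x01 /=; transitivity (- ln (1 - x) - - ln (1 - 0 : R)); last first.
  by rewrite subr0 ln1 oppr0 subr0.
apply: (@FTC_unit _ (fun t => - ln (1 - t)) (fun t => (1 - t)^-1)) => //.
- by move=> t t1; exact: derive_ln1B.
- move=> t t1; apply: derivableV => //.
  by rewrite subr_eq0 gt_eqF // (le_lt_trans (ler_norm t)).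
- by move=> t _; rewrite /omega oner_eq0 mulr1.
Qed.

Lemma iterint_11 x : 0 <= x < 1 -> iterint x [:: 1; 1] = ln (1 - x) ^+ 2 / 2.
Proof.
move=> x01; rewrite [LHS]/= -/(iterint _ [:: 1]).
transitivity (ln (1 - x) ^+ 2 / 2 - ln (1 - 0 : R) ^+ 2 / 2); last first.
  by rewrite subr0 ln1 expr0n /= mul0r subr0.
apply: (@FTC_unit _ (fun t => ln (1 - t) ^+ 2 / 2) (fun t => (1 - t)^-1 * - ln (1 - t))) => //.
- move=> t t1.
  have -> : (fun t : R => ln (1 - t) ^+ 2 / 2) =
      (fun t => 2^-1 * ((- ln (1 - t)) * (- ln (1 - t)))).
    by apply/funext => y; rewrite mulrNN -expr2 mulrC.
  have H := derive_ln1B t1; apply: is_derive_eq.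
  by rewrite /GRing.scale /=; move: (ln _) ((1 - t)^-1) => l i; field.
- move=> t t1; apply: derivableM; last by have [] := derive_ln1B t1.
  by apply: derivableV => //; rewrite subr_eq0 gt_eqF // (le_lt_trans (ler_norm t)).
- move=> t /andP[t0 tx]; rewrite -/(iterint t [:: 1]) iterint_1; first by rewrite /omega oner_eq0.
  by rewrite ltW //= (le_lt_trans tx) //; case/andP: x01.
Qed.

(** Writing H_n^2 = 2 ζ^(n)(1,1) + ζ^(n)(2) and replacing the last sum by its limit expresses ζ^(n)
    through the indices (1,1), (1) and the empty one, whose Abel means are log^2(eps)/2, -log(eps)
    and 1. The leftover constant ζ(2) times the coefficient of T^2 is the correction. *)
Lemma asymp_shuffle k P : posidx k -> asymp (zt^~ k) P ->
  shuffle_reg k (P + (zeta R [:: unb 2] * P`_2)%:P).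
Proof.
move=> kpos [sP HP]; pose z2 := zeta R [:: unb 2].
have z2O : Osq (fun n => zt n [:: unb 2] - z2).
  have [L HL] := @zt_cvg R (unb 2) [::] isT isT isT.
  by rewrite /z2 (Osq_zeta HL).
pose i1 := [:: unb 1]; pose i11 := [:: unb 1; unb 1].
pose e n := zt n k - (2 * P`_2 * zt n i11 + (P`_1 * zt n i1 + (P`_0 + P`_2 * z2) * zt n [::])).
have eO : Osq e.
  apply: (@eq_Osq _ _ _ _ (OsqD HP (OsqZ P`_2 z2O))) => n.
  rewrite /e horner3 // expr2 {2 3}/harm stuffle11 zt_nil /i11 /i1 /unb.
  by rewrite -[emerge _ _]/(2%N, false) /harm; ring.
have := pser_Osq_cvg eO; rewrite /shuffle_reg; apply: cvg_trans; apply: near_eq_cvg; near=> eps.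
have eps0 : 0 < eps by near: eps; exact: nbhs_right_gt.
have eps1 : eps < 1 by near: eps; exact: nbhs_right_lt.
have x01 : 0 <= 1 - eps < 1 by apply/andP; split; lra.
have x1 : `|1 - eps| < 1 by rewrite ger0_norm; lra.
have zg j : posidx j -> cubic_growth (zt^~ j) by move=> jp; apply: (@cubic_lin _ 1) => n; exact: zt_lin.
have eg : cubic_growth e by have [D HD] := Osq_bounded eO; exact: cubic_1 HD.
have E1 : eps * pser (zt^~ i1) (1 - eps) = - ln eps.
  have := iterint_word (isT : posidx i1) x01.
  by rewrite -[word R i1]/[:: 1 * 1] !mulr1 iterint_1 // subKr => /esym.
have E11 : eps * pser (zt^~ i11) (1 - eps) = ln eps ^+ 2 / 2.
  have := iterint_word (isT : posidx i11) x01.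
  by rewrite -[word R i11]/[:: 1 * 1; 1 * 1 * 1] !mulr1 iterint_11 // subKr => /esym.
have E0 : eps * pser (zt^~ [::]) (1 - eps) = 1.
  by have := iterint_word (isT : posidx [::]) x01; rewrite subKr => /esym.
rewrite iterint_word // subKr.
have -> : zt^~ k = (fun n => (2 * P`_2 * zt n i11 + (P`_1 * zt n i1 +
    (P`_0 + P`_2 * z2) * zt n [::])) + e n).
  by apply/funext => n; rewrite /e addrC subrK.
have [[g11 g1] g0] := (zg i11 isT, zg i1 isT, zg [::] isT).
have gA := cubicZ (2 * P`_2) g11; have gB := cubicZ P`_1 g1.
have gC := cubicZ (P`_0 + P`_2 * z2) g0; have gBC := cubicD gB gC.
rewrite (pserD (cubicD gA gBC) eg x1) (pserD gA gBC x1) (pserD gB gC x1).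
rewrite (pserZ _ g11 x1) (pserZ _ g1 x1) (pserZ _ g0 x1).
rewrite hornerD hornerC horner3 // -/z2.
transitivity (2 * P`_2 * (eps * pser (zt^~ i11) (1 - eps)) + (P`_1 * (eps * pser (zt^~ i1) (1 - eps))
  + (P`_0 + P`_2 * z2) * (eps * pser (zt^~ [::]) (1 - eps))) + eps * pser e (1 - eps) -
  (P`_0 + P`_1 * - ln eps + P`_2 * (- ln eps) ^+ 2 + z2 * P`_2)); last by ring.
by rewrite E1 E11 E0; field.
Unshelve. all: by end_near. Qed.

Lemma shuffle_reg_unique k P Q : shuffle_reg k P -> shuffle_reg k Q -> P = Q.
Proof.
move=> HP HQ; apply/eqP; rewrite -subr_eq0; apply/eqP.
apply: (@poly_cvg0 _ _ (0^'+) _ (fun eps : R => - ln eps)).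
  by apply/(cvgNry (fun eps : R => ln eps)); exact: lnNy.
rewrite (_ : (fun x => _) =
    (fun eps => (iterint (1 - eps) (word R k) - Q.[- ln eps]) -
                (iterint (1 - eps) (word R k) - P.[- ln eps]))); last first.
  by apply/funext => n; rewrite hornerD hornerN; ring.
by have := cvgB HQ HP; rewrite subr0 => H; exact: H.
Qed.

Lemma asymp_zeta_sh k P : posidx k -> asymp (zt^~ k) P ->
  zeta_sh R k = P + (zeta R [:: unb 2] * P`_2)%:P.
Proof.
move=> kpos HP; apply: xget_unique; first exact: asymp_shuffle.
move=> Q HQ; apply: shuffle_reg_unique HQ _; exact: asymp_shuffle.
Qed.

End AbelMeans.

(** * The six identities *)

Section Assembly.
Variable R : realType.
Implicit Types (n u M : nat) (k : eindex) (P Q : {poly R}) (al be ga : bool) (s t : nat * bool).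

Local Notation zt := (@zeta_trunc R).
Local Notation harm := (@harm R).
Local Notation Z k := ((zeta R k)%:P).
Local Notation z2 := (zeta R [:: unb 2]).

Lemma zeta_Osq s k : s != (1%N, false) -> posidx (s :: k) -> (size k <= 2)%N ->
  Osq (fun n => zt n (s :: k) - zeta R (s :: k)).
Proof. by move=> s1 kpos k2; have [L HL] := zt_cvg R s1 kpos k2; rewrite (Osq_zeta HL). Qed.

Lemma asymp_conv s k : s != (1%N, false) -> posidx (s :: k) -> (size k <= 2)%N ->
  asymp (zt^~ (s :: k)) (Z (s :: k)).
Proof. by move=> *; apply: asympC; exact: zeta_Osq. Qed.

Lemma zeta_st_conv s k : s != (1%N, false) -> posidx (s :: k) -> (size k <= 2)%N ->
  zeta_st R (s :: k) = Z (s :: k).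
Proof. by move=> *; apply: asymp_zeta_st; exact: asymp_conv. Qed.

Definition regular k := asymp (zt^~ k) (zeta_st R k).

Lemma asymp_regular k P : asymp (zt^~ k) P -> regular k /\ zeta_st R k = P.
Proof. by move=> H; rewrite /regular (asymp_zeta_st H). Qed.

Lemma regular_conv s k : s != (1%N, false) -> posidx (s :: k) -> (size k <= 2)%N ->
  regular (s :: k).
Proof. by move=> *; apply: (asymp_regular _).1; exact: asymp_conv. Qed.

Lemma regular_div1 s k : s != (1%N, false) -> posidx (s :: k) -> (size k <= 2)%N ->
  regular [:: unb 1, s & k] /\ (zeta_st R [:: unb 1, s & k])`_2 = 0.
Proof.
move=> s1 kpos k2; have [C HC] := zt_div (zeta_Osq s1 kpos k2).
have H : asymp (zt^~ [:: unb 1, s & k]) (zeta R (s :: k) *: 'X + C%:P).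
  apply: (@asymp_Osq R (fun n => zeta R (s :: k) * harm n + C)); last first.
    apply: asympD; first by apply: asympZ; exact: asymp_harm.
    by apply: asympC; apply: (eq_Osq _ (Osq0 R)) => n; rewrite subrr.
  apply: (eq_Osq _ (OsqN HC)) => n; rewrite opprB; congr (_ + _ - _).
  by rewrite sum1Mr -harmE mulrC.
have [Hr ->] := asymp_regular H; split=> //.
by rewrite coefD coefZ coefX coefC mulr0 addr0.
Qed.

Lemma zt11E n : zt n [:: unb 1; unb 1] = (harm n ^+ 2 - zt n [:: unb 2]) / 2.
Proof.
rewrite expr2 /harm stuffle11 -[emerge _ _]/(unb 2); by field.
Qed.

(** Two applications of [zt_div]: the model ζ(s) H + C, divided by i and summed, involves ζ^(n)(1,1)
    = (H_n^2 - ζ^(n)(2))/2, which accounts for the half. *)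
Lemma regular_div2 s : s != (1%N, false) -> (0 < s.1)%N ->
  regular [:: unb 1; unb 1; s] /\ (zeta_st R [:: unb 1; unb 1; s])`_2 = zeta R [:: s] / 2.
Proof.
move=> s1 s0; have sp : posidx [:: s] by rewrite /= s0.
have [C HC] := zt_div (zeta_Osq s1 sp isT).
pose e n := zeta R [:: s] * harm n + C.
have HC' : Osq (fun n => zt n [:: unb 1; s] - e n).
  by apply: (eq_Osq _ HC) => n; rewrite /e sum1Mr -harmE mulrC.
have [C' HC''] := zt_div HC'.
pose P := (zeta R [:: s] / 2) *: ('X^2 - z2%:P) + (C *: 'X + C'%:P).
have H : asymp (zt^~ [:: unb 1; unb 1; s]) P.
  apply: (@asymp_Osq R (fun n => (zeta R [:: s] / 2) * (harm n ^+ 2 - zt n [:: unb 2]) +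
     (C * harm n + C'))); last first.
    apply: asympD.
      apply: asympZ; apply: asympB; first exact: asymp_harm2.
      exact: asymp_conv.
    apply: asympD; first by apply: asympZ; exact: asymp_harm.
    by apply: asympC; apply: (eq_Osq _ (Osq0 R)) => n; rewrite subrr.
  apply: (eq_Osq _ (OsqN HC'')) => n; rewrite opprB; congr (_ - _).
  rewrite addrA; congr (_ + _).
  have -> : sum1 n (fun i => i%:R^-1 * e i.-1) =
     zeta R [:: s] * zt n [:: unb 1; unb 1] + C * harm n.
    rewrite [zt n [:: _; _]]zt_cons harmE -!sum1Ml -sum1D; apply: eq_sum1 => i _.
    by rewrite wt1 /e /harm; ring.
  by rewrite zt11E; field.
have [Hr ->] := asymp_regular H; split=> //.
by rewrite /P !(coefD, coefZ, coefN, coefXn, coefX, coefC) /=; ring.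
Qed.

Lemma regular3 (a b c : nat) (z y x : bool) :
  (0 < a)%N -> (0 < b)%N -> (0 < c)%N -> (3 < a + b + c)%N ->
  regular [:: (a, z); (b, y); (c, x)].
Proof.
move=> a0 b0 c0 abc.
have [[a1 z1]|az] := eqVneq (a, z) (1%N, false); last first.
  by apply: regular_conv => //=; rewrite a0 b0 c0.
have [[b1 y1]|by_] := eqVneq (b, y) (1%N, false); last first.
  by rewrite a1 z1; apply: (regular_div1 _ _ _).1 => //=; rewrite b0 c0.
rewrite a1 z1 b1 y1; apply: (regular_div2 _ _).1 => //.
by apply/eqP => -[c1 _]; move: abc; rewrite a1 b1 c1.
Qed.

Definition shreg P : {poly R} := P + (z2 * P`_2)%:P.

Lemma shregD P Q : shreg (P + Q) = shreg P + shreg Q.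
Proof. by rewrite /shreg coefD mulrDr polyCD addrACA. Qed.

Lemma shregZ (a : R) P : shreg (a *: P) = a *: shreg P.
Proof. by rewrite /shreg coefZ scalerDr mulrCA polyCM [a%:P * _]mul_polyC. Qed.

Lemma shreg_sum1 n (F : nat -> {poly R}) : shreg (sum1 n F) = sum1 n (fun i => shreg (F i)).
Proof.
elim: n => [|n IH]; last by rewrite !sum1S shregD IH.
by rewrite !sum1_0 /shreg coef0 mulr0 polyC0 addr0.
Qed.

Lemma regular_sh k : posidx k -> regular k -> zeta_sh R k = shreg (zeta_st R k).
Proof. by move=> kpos /(asymp_zeta_sh kpos). Qed.

Definition stsum u al be ga : {poly R} :=
  sum1 u (fun a => sum1 (u.+1 - a) (fun b => (2 ^+ b.-1 : R) *:
    (zeta_st R [:: (a, al); (b, al (+) be); ((u.+2 - a - b)%N, be (+) ga)] +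
     zeta_st R [:: (a, al); (b, al (+) ga); ((u.+2 - a - b)%N, be (+) ga)]))).

Lemma asymp_stsum u al be ga : (1 < u)%N ->
  asymp (simplex_sum R u al be ga) (stsum u al be ga).
Proof.
move=> u1; apply: (eq_asymp (fun M => weighted_sum_simplex R u al be ga M)).
apply: asymp_sum1 => a /andP[a0 au]; apply: asymp_sum1 => b /andP[b0 bu].
by apply: asympZ; apply: asympD; apply: regular3 => //; lia.
Qed.

Lemma shsumE u al be ga : (1 < u)%N ->
  sum1 u (fun a => sum1 (u.+1 - a) (fun b => (2 ^+ b.-1 : R) *:
    (zeta_sh R [:: (a, al); (b, al (+) be); ((u.+2 - a - b)%N, be (+) ga)] +
     zeta_sh R [:: (a, al); (b, al (+) ga); ((u.+2 - a - b)%N, be (+) ga)]))) =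
  shreg (stsum u al be ga).
Proof.
move=> u1; rewrite /stsum shreg_sum1; apply: eq_sum1 => a /andP[a0 au].
rewrite shreg_sum1; apply: eq_sum1 => b /andP[b0 bu]; rewrite shregZ shregD.
have c0 : (0 < u.+2 - a - b)%N by lia.
by rewrite !regular_sh //=; do ?[apply: regular3 => //; lia]; rewrite a0 b0 c0.
Qed.

(** The Cauchy defects are kept here rather than discarded, since their limits depend on the
    signs. *)
Definition mainS u al be ga M : R :=
  mainA R u al be ga M + mainA R u al ga be M + partC R u al be ga M + mainD R u al be ga M
  + convdef R al ga M * zt M [:: (u, be (+) (al (+) ga))]
  + convdef R al be M * zt M [:: (u, ga (+) (al (+) be))].

Lemma Osq_mainS u al be ga : (1 < u)%N ->
  Osq (fun M => mainS u al be ga M - simplex_sum R u al be ga M).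
Proof.
move=> u1.
have H1 := Osq_partA R al be ga u1; have H2 := Osq_partA R al ga be u1.
have H3 := Osq_partD R al be ga u1.
have H4 := Osq_sum_corner R al ga (be (+) (al (+) ga)) u1.
have H5 := Osq_sum_corner R al be (ga (+) (al (+) be)) u1.
apply: (eq_Osq _ (OsqD (OsqB H4 H1) (OsqB (OsqB H5 H2) H3))) => M.
by rewrite simplex_sumE !sum1_innerE /mainS; ring.
Qed.

(** Odd terms cancel and even ones double: 2/(2m)^2 is half of 1/m^2. *)
Lemma zeta_double n : zt n.*2 [:: bar 2] + zt n.*2 [:: unb 2] = zt n [:: unb 2] / 2.
Proof.
elim: n => [|n IH]; first by rewrite !zt_0 addr0 mul0r.
rewrite doubleS !ztS !zt_nil !mulr1 mulrDl -IH /wt /= !ch_false /ch /=.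
rewrite !exprS -mul2n exprM sqrrN !expr1n !mul1r !mulr1 -!natr1 natrM.
have n1 : n%:R + 1 != 0 :> R by rewrite natr1 pnatr_eq0.
have n2 : 2 * n%:R + 1 != 0 :> R by rewrite -natrM natr1 pnatr_eq0.
have n3 : 2 * n%:R + 1 + 1 != 0 :> R by rewrite -natrM !natr1 pnatr_eq0.
by field; rewrite n1 n2 n3.
Qed.

Lemma zeta_bar2 : zeta R [:: bar 2] = - z2 / 2.
Proof.
have [C HC] := zeta_Osq (s := bar 2) (k := [::]) isT isT isT.
have [D HD] := zeta_Osq (s := unb 2) (k := [::]) isT isT isT.
have dbl (f : nat -> R) (B : R) : (forall n, `|f n| <= B / sq R n) -> Osq (fun n => f n.*2).
  move=> HB; exists B => n; apply: (le_trans (HB _)).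
  have B0 : 0 <= B.
    have := le_trans (normr_ge0 _) (HB 0%N); rewrite pmulr_lge0 // invr_gt0; exact: sq_gt0.
  rewrite ler_wpM2l // lef_pV2 ?posrE ?sq_gt0 // sq_le // -addnn; lia.
have H := OsqB (OsqD (dbl _ _ HC) (dbl _ _ HD)) (OsqZ 2^-1 (ex_intro _ D HD)).
have H0 : Osq (fun=> zeta R [:: bar 2] + z2 - z2 / 2).
  apply: (eq_Osq _ (OsqN H)) => n; have := zeta_double n => E.
  by rewrite (_ : zt n [:: unb 2] = 2 * (zt n.*2 [:: bar 2] + zt n.*2 [:: unb 2])); [field | rewrite E; field].
have := asymp_unique (asympC (L := zeta R [:: bar 2] + z2 - z2 / 2) (eq_Osq (fun n => esym (subrr _)) (Osq0 R)))
  (asympC (L := 0) (eq_Osq (fun n => esym (subr0 _)) H0)).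
by move=> /polyC_inj; lra.
Qed.

(** The null sequence that lets products with ζ(2) be traded for products with ζ(bar 2). *)
Lemma Osq_bar2 : Osq (fun n => zt n [:: unb 2] + 2 * zt n [:: bar 2]).
Proof.
have H1 := zeta_Osq (s := bar 2) (k := [::]) isT isT isT.
have H2 := zeta_Osq (s := unb 2) (k := [::]) isT isT isT.
apply: (eq_Osq _ (OsqD H2 (OsqZ 2 H1))) => n.
by rewrite zeta_bar2; field.
Qed.

End Assembly.

(** * The stuffle-regularized sums for the six sign patterns *)

Section Cases.
Variable R : realType.
Implicit Types (n u M : nat) (k : eindex) (P Q : {poly R}) (al be ga : bool) (s t : nat * bool).

Local Notation zt := (@zeta_trunc R).
Local Notation Z k := ((zeta R k)%:P).
Local Notation Zst := (zeta_st R).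
Local Notation z2 := (zeta R [:: unb 2]).

Lemma stsum_eq u al be ga (f : nat -> R) P : (1 < u)%N -> asymp f P ->
  Osq (fun M => f M - mainS R u al be ga M) -> stsum R u al be ga = P.
Proof.
move=> u1 fP fO; apply: asymp_unique (asymp_stsum R al be ga u1) _.
apply: asymp_Osq fP.
by apply: (eq_Osq _ (OsqD fO (Osq_mainS R al be ga u1))) => M; ring.
Qed.

Lemma asympM s t : s != (1%N, false) -> t != (1%N, false) ->
  (0 < s.1)%N -> (0 < t.1)%N ->
  asymp (fun M => zt M [:: s] * zt M [:: t]) (zeta R [:: s] * zeta R [:: t])%:P.
Proof.
move=> s1 t1 s0 t0; apply: asympC; apply: OsqM; apply: zeta_Osq => //=.
  by rewrite s0.
by rewrite t0.
Qed.

Lemma eq_Osq0 (f g : nat -> R) : f =1 g -> Osq (fun n => f n - g n).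
Proof. by move=> fg; apply: (eq_Osq _ (Osq0 R)) => n; rewrite fg subrr. Qed.

Lemma Osq_zetaM f s k : s != (1%N, false) -> posidx (s :: k) -> (size k <= 2)%N ->
  Osq f -> Osq (fun M => f M * zt M (s :: k)).
Proof.
move=> s1 kpos k2 fO; have H := zeta_Osq R s1 kpos k2; have [D HD] := Osq_bounded H.
apply: (@OsqMb R f _ (D + `|zeta R (s :: k)|)) => // M.
by rewrite -[zt M _](subrK (zeta R (s :: k))) (le_trans (ler_normD _ _)) // lerD2r.
Qed.

Ltac expand_main :=
  rewrite /mainS partCE sum1_wt_conv11 /mainA /mainD /=
    ?(mulrBr, stuffle12) /emerge /= ?(add1n, addn1, add2n, addn2).

Ltac asymp_tac :=
  lazymatch goal with
  | |- asymp _ (?P - ?Q) => apply: asympB; asymp_tac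
  | |- asymp _ (?P + ?Q) => apply: asympD; asymp_tac
  | |- asymp _ (?c *: ?P) => apply: asympZ; asymp_tac
  | |- asymp _ (zeta_st _ [:: unb 1; unb 1; _]) => apply: (regular_div2 R _ _).1
  | |- asymp _ (zeta_st _ (unb 1 :: _)) => apply: (regular_div1 R _ _ _).1
  | |- asymp _ (_ * _)%:P => apply: asympM
  | |- asymp _ (zeta _ _)%:P => apply: asymp_conv
  end.


Ltac side_tac := rewrite //= ?andbT //; first [by apply/eqP => -[]; lia | lia].

(** In the limit this is the relation 2 ζ(bar 1, 1) - 2 ζ(bar 1, bar 1) = ζ(2). The expansion is
    needed where this defect must be used with a coefficient other than the one it has in
    [mainS]. *)
Lemma convdef_ttM M s : convdef R true true M * zt M [:: s] =
  2 * (zt M [:: s] * zt M [:: bar 1; unb 1]) - 2 * (zt M [:: s] * zt M [:: bar 1; bar 1])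
  - zt M [:: s] * zt M [:: unb 2].
Proof. by rewrite /convdef conv11E stuffle11 /emerge /= addn1; ring. Qed.

(** The last term, absent from the shuffle version, is cancelled there by the correction of 2
    ζ_*(1,1,u), whose coefficient of T^2 is ζ(u). *)
Lemma stsum1 u : (1 < u)%N -> stsum R u false false false =
  2 *: Zst [:: unb 1; unb 1; unb u] + u.+2%:R *: Zst [:: unb 1; unb u.+1]
    - 2 *: Z [:: unb u; unb 2] - Z [:: unb u.+2] - (z2 * zeta R [:: unb u])%:P.
Proof.
move=> u1; apply: (@stsum_eq _ _ _ _ (fun M => 2 * zt M [:: unb 1; unb 1; unb u] +
   u.+2%:R * zt M [:: unb 1; unb u.+1] - 2 * zt M [:: unb u; unb 2] - zt M [:: unb u.+2]
   - zt M [:: unb 2] * zt M [:: unb u])) => //.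
  by asymp_tac; side_tac.
apply: eq_Osq0 => M; rewrite /unb.
expand_main; rewrite !convdef_ff !mulNr !stuffle11 /emerge /= ?(add1n, addn1, add2n, addn2) -!natr1.
by ring.
Qed.

Lemma stsum2 u : (1 < u)%N -> stsum R u false true true =
  4 *: Z [:: unb u; bar 1; bar 1] - 4 *: Z [:: unb u; bar 1; unb 1]
    - 2 *: Z [:: bar 1; bar 1; unb u] + 2 *: Z [:: bar 1; unb 1; unb u]
    + 2 *: Zst [:: unb 1; bar 1; unb u] + 2 *: Z [:: bar u.+1; bar 1]
    - 2 *: Z [:: bar u.+1; unb 1]
    + u%:R *: Zst [:: unb 1; unb u.+1] + 2 *: Zst [:: unb 1; bar u.+1]
    + 4 *: Z [:: bar 2; unb u] + 2 *: Z [:: unb u; unb 2]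
    + Z [:: unb u.+2] + 2 *: Z [:: bar u.+2].
Proof.
move=> u1; apply: (@stsum_eq _ _ _ _ (fun M =>
  4 * zt M [:: unb u; bar 1; bar 1] - 4 * zt M [:: unb u; bar 1; unb 1]
    - 2 * zt M [:: bar 1; bar 1; unb u] + 2 * zt M [:: bar 1; unb 1; unb u]
    + 2 * zt M [:: unb 1; bar 1; unb u] + 2 * zt M [:: bar u.+1; bar 1]
    - 2 * zt M [:: bar u.+1; unb 1]
    + u%:R * zt M [:: unb 1; unb u.+1] + 2 * zt M [:: unb 1; bar u.+1]
    + 4 * zt M [:: bar 2; unb u] + 2 * zt M [:: unb u; unb 2]
    + zt M [:: unb u.+2] + 2 * zt M [:: bar u.+2])) => //.
  by asymp_tac; side_tac.
have H : Osq (fun M => (zt M [:: unb 2] + 2 * zt M [:: bar 2]) * zt M [:: unb u]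
    - 2 * (convdef R false true M * zt M [:: unb u])).
  apply: OsqB; first by apply: Osq_zetaM; [side_tac | side_tac | | exact: Osq_bar2].
  by apply: OsqZ; apply: Osq_zetaM; [side_tac | side_tac | | exact: Osq_convdef].
apply: (eq_Osq _ H) => M; rewrite /unb /bar mulrDl -[2 * _ * _]mulrA.
expand_main; rewrite !stuffle11 /emerge /= ?(add1n, addn1, add2n, addn2).
by ring.
Qed.

Lemma stsum3 u : (1 < u)%N -> stsum R u true true true =
  2 *: Z [:: bar 1; bar 1; bar u] + u.+2%:R *: Z [:: bar 1; bar u.+1]
    + 2 *: Z [:: bar u.+1; bar 1] - 2 *: Z [:: bar u.+1; unb 1]
    + Z [:: bar 2; bar u] + Z [:: unb 2; bar u] + 2 *: Z [:: unb u.+2]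
    - Z [:: bar u.+2] + (z2 * zeta R [:: bar u])%:P.
Proof.
move=> u1; apply: (@stsum_eq _ _ _ _ (fun M =>
  2 * zt M [:: bar 1; bar 1; bar u] + u.+2%:R * zt M [:: bar 1; bar u.+1]
    + 2 * zt M [:: bar u.+1; bar 1] - 2 * zt M [:: bar u.+1; unb 1]
    + zt M [:: bar 2; bar u] + zt M [:: unb 2; bar u] + 2 * zt M [:: unb u.+2]
    - zt M [:: bar u.+2] + zt M [:: unb 2] * zt M [:: bar u])) => //.
  by asymp_tac; side_tac.
have H : Osq (fun M => (zt M [:: unb 2] + 2 * zt M [:: bar 2]) * zt M [:: bar u]
    - convdef R true true M * zt M [:: bar u]).
  by apply: OsqB; apply: Osq_zetaM; try side_tac; [exact: Osq_bar2 | exact: Osq_convdef].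
apply: (eq_Osq _ H) => M; rewrite /unb /bar mulrDl -[2 * _ * _]mulrA.
expand_main; rewrite !convdef_ttM ?stuffle12 !stuffle11 /emerge /= ?(add1n, addn1, add2n, addn2) -!natr1.
by ring.
Qed.

Lemma stsum4 u : (1 < u)%N -> stsum R u true false false =
  2 *: Z [:: bar 1; bar 1; bar u] + u%:R *: Z [:: bar 1; bar u.+1]
    + 2 *: Z [:: bar 1; unb u.+1] + Z [:: bar 2; bar u] + Z [:: unb 2; bar u]
    + Z [:: bar u.+2].
Proof.
move=> u1; apply: (@stsum_eq _ _ _ _ (fun M =>
  2 * zt M [:: bar 1; bar 1; bar u] + u%:R * zt M [:: bar 1; bar u.+1]
    + 2 * zt M [:: bar 1; unb u.+1] + zt M [:: bar 2; bar u] + zt M [:: unb 2; bar u]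
    + zt M [:: bar u.+2])) => //.
  by asymp_tac; side_tac.
have H : Osq (fun M => - (convdef R true true M * zt M [:: bar u])
    - 2 * (convdef R true false M * zt M [:: bar u])).
  apply: OsqB; first by apply: OsqN; apply: Osq_zetaM; try side_tac; exact: Osq_convdef.
  by apply: OsqZ; apply: Osq_zetaM; try side_tac; exact: Osq_convdef.
apply: (eq_Osq _ H) => M; rewrite /unb /bar.
expand_main; rewrite !convdef_ttM ?stuffle12 !stuffle11 /emerge /= ?(add1n, addn1, add2n, addn2).
by ring.
Qed.

Lemma stsum5 u : (1 < u)%N -> stsum R u true false true =
  2 *: Z [:: unb u; bar 1; unb 1] + 2 *: Z [:: bar 1; bar 1; unb u]
    - 2 *: Z [:: unb u; bar 1; bar 1] + u.+1%:R *: Z [:: bar 1; unb u.+1]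
    + Z [:: bar u.+1; unb 1] + Z [:: bar 1; bar u.+1]
    - Z [:: bar u.+1; bar 1] + Z [:: unb 2; unb u] - Z [:: unb u; unb 2].
Proof.
move=> u1; apply: (@stsum_eq _ _ _ _ (fun M =>
  2 * zt M [:: unb u; bar 1; unb 1] + 2 * zt M [:: bar 1; bar 1; unb u]
    - 2 * zt M [:: unb u; bar 1; bar 1] + u.+1%:R * zt M [:: bar 1; unb u.+1]
    + zt M [:: bar u.+1; unb 1] + zt M [:: bar 1; bar u.+1]
    - zt M [:: bar u.+1; bar 1] + zt M [:: unb 2; unb u] - zt M [:: unb u; unb 2])) => //.
  by asymp_tac; side_tac.
have H : Osq (fun M => - (convdef R true true M * zt M [:: unb u])
    - convdef R true false M * zt M [:: unb u]).
  apply: OsqB; first by apply: OsqN; apply: Osq_zetaM; try side_tac; exact: Osq_convdef.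
  by apply: Osq_zetaM; try side_tac; exact: Osq_convdef.
apply: (eq_Osq _ H) => M; rewrite /unb /bar.
expand_main; rewrite -!natr1.
by ring.
Qed.

Lemma stsum6 u : (1 < u)%N -> stsum R u false false true =
  Zst [:: unb 1; bar 1; bar u] + Z [:: bar 1; unb 1; bar u]
    - Z [:: bar 1; bar 1; bar u] + Zst [:: unb 1; unb 1; bar u]
    - Z [:: bar u.+1; bar 1] + Z [:: bar u.+1; unb 1]
    + Zst [:: unb 1; unb u.+1] + u.+1%:R *: Zst [:: unb 1; bar u.+1]
    + Z [:: bar 2; bar u] + Z [:: unb 2; bar u] + Z [:: bar u.+2]
    + 3 *: (zeta R [:: bar 2] * zeta R [:: bar u])%:P
    - 2^-1 *: (z2 * zeta R [:: bar u])%:P.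
Proof.
move=> u1; apply: (@stsum_eq _ _ _ _ (fun M =>
  zt M [:: unb 1; bar 1; bar u] + zt M [:: bar 1; unb 1; bar u]
    - zt M [:: bar 1; bar 1; bar u] + zt M [:: unb 1; unb 1; bar u]
    - zt M [:: bar u.+1; bar 1] + zt M [:: bar u.+1; unb 1]
    + zt M [:: unb 1; unb u.+1] + u.+1%:R * zt M [:: unb 1; bar u.+1]
    + zt M [:: bar 2; bar u] + zt M [:: unb 2; bar u] + zt M [:: bar u.+2]
    + 3 * (zt M [:: bar 2] * zt M [:: bar u])
    - 2^-1 * (zt M [:: unb 2] * zt M [:: bar u]))) => //.
  by asymp_tac; side_tac.
(* Besides the listed sums, the product of ζ(2) and ζ(bar u) occurs with coefficient -2. The factor
   3/2 rewrites -2 ζ(2) as 3 ζ(bar 2) - ζ(2)/2, and the correction of ζ_*(1, 1, bar u) cancels the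
   last half. *)
have H : Osq (fun M => 3 / 2 * ((zt M [:: unb 2] + 2 * zt M [:: bar 2]) * zt M [:: bar u])
    - convdef R false true M * zt M [:: bar u]).
  apply: OsqB; first by apply: OsqZ; apply: Osq_zetaM; try side_tac; exact: Osq_bar2.
  by apply: Osq_zetaM; try side_tac; exact: Osq_convdef.
apply: (eq_Osq _ H) => M; rewrite /unb /bar [(_ + 2 * _) * _]mulrDl -[2 * _ * _]mulrA.
expand_main; rewrite !convdef_ff !mulNr !stuffle11 /emerge /= ?(add1n, addn1, add2n, addn2) -!natr1.
by field.
Qed.

Lemma st_div1_coef s k : s != (1%N, false) -> posidx (s :: k) -> (size k <= 2)%N ->
  (Zst [:: unb 1, s & k])`_2 = 0.
Proof. by move=> *; apply: (regular_div1 R _ _ _).2. Qed.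

Lemma st_div2_coef s : s != (1%N, false) -> (0 < s.1)%N ->
  (Zst [:: unb 1; unb 1; s])`_2 = zeta R [:: s] / 2.
Proof. by move=> *; apply: (regular_div2 R _ _).2. Qed.

(** When [be] = [ga] the two words of the shuffle coincide, which explains the extra factor 2 in the
    first four identities; in the last two the words differ. *)
Lemma sum3_double u (F : nat -> nat -> nat -> {poly R}) :
  sum3 u.+2 (fun a b c => (2 * 2 ^+ b.-1 : R) *: F a b c) =
  sum1 u (fun a => sum1 (u.+1 - a) (fun b => (2 ^+ b.-1 : R) *:
    (F a b (u.+2 - a - b)%N + F a b (u.+2 - a - b)%N))).
Proof.
rewrite /sum3 sum3_sum1; apply: eq_sum1 => a _; apply: eq_sum1 => b _.
by rewrite mulrC -scalerA scaler_nat mulr2n.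
Qed.

(** A leading bar makes every index convergent, so ordinary values may be read as regularized
    ones. *)
Lemma stsum_conv u be ga :
  sum1 u (fun a => sum1 (u.+1 - a) (fun b => (2 ^+ b.-1 : R) *:
    (Z [:: (a, true); (b, true (+) be); ((u.+2 - a - b)%N, be (+) ga)] +
     Z [:: (a, true); (b, true (+) ga); ((u.+2 - a - b)%N, be (+) ga)]))) =
  stsum R u true be ga.
Proof.
apply: eq_sum1 => a /andP[a0 au]; apply: eq_sum1 => b /andP[b0 bu].
have c0 : (0 < u.+2 - a - b)%N by lia.
by rewrite !zeta_st_conv //= ?a0 ?b0 ?c0 //; apply/eqP => -[].
Qed.

End Cases.

Theorem theorem5p8 (R : realType) (w : nat) (hw : (4 <= w)%N) :
  let u := (w - 2)%N in
  let v := (w - 1)%N in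
  let Z (k : eindex) : {poly R} := (zeta R k)%:P in
  let Zst := @zeta_st R in
  let Zsh := @zeta_sh R in
  (* (1) *)
  sum3 w (fun a b c => (2 * 2 ^+ b.-1 : R) *: Zsh [:: unb a; unb b; unb c])
  = 2%:R *: Zst [:: unb 1; unb 1; unb u] + w%:R *: Zst [:: unb 1; unb v]
    - 2%:R *: Z [:: unb u; unb 2] - Z [:: unb w]
  /\
  (* (2) *)
  sum3 w (fun a b c => (2 * 2 ^+ b.-1 : R) *: Zsh [:: unb a; bar b; unb c])
  = 4%:R *: Z [:: unb u; bar 1; bar 1] - 4%:R *: Z [:: unb u; bar 1; unb 1]
    - 2%:R *: Z [:: bar 1; bar 1; unb u] + 2%:R *: Z [:: bar 1; unb 1; unb u]
    + 2%:R *: Zst [:: unb 1; bar 1; unb u] + 2%:R *: Z [:: bar v; bar 1]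
    - 2%:R *: Z [:: bar v; unb 1]
    + u%:R *: Zst [:: unb 1; unb v] + 2%:R *: Zst [:: unb 1; bar v]
    + 4%:R *: Z [:: bar 2; unb u] + 2%:R *: Z [:: unb u; unb 2]
    + Z [:: unb w] + 2%:R *: Z [:: bar w]
  /\
  (* (3) *)
  sum3 w (fun a b c => (2 * 2 ^+ b.-1 : R) *: Z [:: bar a; unb b; unb c])
  = 2%:R *: Z [:: bar 1; bar 1; bar u] + w%:R *: Z [:: bar 1; bar v]
    + 2%:R *: Z [:: bar v; bar 1] - 2%:R *: Z [:: bar v; unb 1]
    + Z [:: bar 2; bar u] + Z [:: unb 2; bar u] + 2%:R *: Z [:: unb w]
    - Z [:: bar w] + (zeta R [:: unb 2] * zeta R [:: bar u])%:P
  /\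
  (* (4) *)
  sum3 w (fun a b c => (2 * 2 ^+ b.-1 : R) *: Z [:: bar a; bar b; unb c])
  = 2%:R *: Z [:: bar 1; bar 1; bar u] + u%:R *: Z [:: bar 1; bar v]
    + 2%:R *: Z [:: bar 1; unb v] + Z [:: bar 2; bar u] + Z [:: unb 2; bar u]
    + Z [:: bar w]
  /\
  (* (5) *)
  sum3 w (fun a b c => (2 ^+ b.-1 : R) *:
            (Zsh [:: bar a; bar b; bar c] + Zsh [:: bar a; unb b; bar c]))
  = 2%:R *: Z [:: unb u; bar 1; unb 1] + 2%:R *: Z [:: bar 1; bar 1; unb u]
    - 2%:R *: Z [:: unb u; bar 1; bar 1] + v%:R *: Z [:: bar 1; unb v]
    + Z [:: bar v; unb 1] + Z [:: bar 1; bar v]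
    - Z [:: bar v; bar 1] + Z [:: unb 2; unb u] - Z [:: unb u; unb 2]
  /\
  (* (6) *)
  sum3 w (fun a b c => (2 ^+ b.-1 : R) *:
            (Zsh [:: unb a; unb b; bar c] + Zsh [:: unb a; bar b; bar c]))
  = Zst [:: unb 1; bar 1; bar u] + Z [:: bar 1; unb 1; bar u]
    - Z [:: bar 1; bar 1; bar u] + Zst [:: unb 1; unb 1; bar u]
    - Z [:: bar v; bar 1] + Z [:: bar v; unb 1]
    + Zst [:: unb 1; unb v] + v%:R *: Zst [:: unb 1; bar v]
    + Z [:: bar 2; bar u] + Z [:: unb 2; bar u] + Z [:: bar w]
    + 3%:R *: (zeta R [:: bar 2] * zeta R [:: bar u])%:P.
Proof.
case: w hw => [|[|u]] // u1; rewrite !subSS !subn0 /=.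
have u0 : (0 < u)%N by lia.
have Eq b : (zeta_st R [:: unb 1; unb 1; (u, b)])`_2 = zeta R [:: (u, b)] / 2.
  by apply: st_div2_coef => //; apply/eqP => -[]; lia.
have El b : (zeta_st R [:: unb 1; (u.+1, b)])`_2 = 0.
  by apply: st_div1_coef => //; apply/eqP => -[]; lia.
have El3 b : (zeta_st R [:: unb 1; bar 1; (u, b)])`_2 = 0.
  by apply: st_div1_coef => //=; rewrite u0.
have coefs := (coefD, coefN, coefZ, coefC, Eq false, Eq true, El false, El true,
  El3 false, El3 true).
split; [|split; [|split; [|split; [|split]]]].
- rewrite sum3_double (shsumE R false false false) // stsum1 // /shreg !coefs /=.
  rewrite (_ : _ * (_ - _) = zeta R [:: unb 2] * zeta R [:: unb u]); last by field.
  by rewrite subrK.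
- rewrite sum3_double (shsumE R false true true) // stsum2 // /shreg !coefs /=.
  by rewrite !(mulr0, addr0, subr0, polyC0).
- by rewrite sum3_double (stsum_conv R u true true) stsum3.
- by rewrite sum3_double (stsum_conv R u false false) stsum4.
- rewrite /sum3 sum3_sum1 (shsumE R true false true) // stsum5 // /shreg !coefs /=.
  by rewrite !(mulr0, addr0, subr0, polyC0).
- rewrite /sum3 sum3_sum1 (shsumE R false false true) // stsum6 // /shreg !coefs /=.
  rewrite !(mulr0, addr0, add0r, subr0).
  set z := zeta R [:: unb 2]; set y := zeta R [:: bar u].
  have -> : (z * (y / 2))%:P = 2^-1 *: (z * y)%:P.
    by rewrite -mul_polyC -polyCM; congr polyC; ring.
  by rewrite subrK.
Qed.
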